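(* Let $A$ be a unital separable simple $C^*$-algebra and $\alpha$ a flow on $A$. If $\alpha$ is an approximately inner compact flow, then the domain $D(\delta_\alpha)$ of the generator of $\alpha$ contains a maximal abelian $C^*$-subalgebra of $A$.
   Context: A flow $\alpha=(\alpha_t)_{t\in\mathbb R}$ on $A$ is a strongly continuous one-parameter group of *-automorphisms of $A$ (i.e. $t\mapsto\alpha_t(x)$ is norm continuous for each $x\in A$). Its infinitesimal generator is the closed derivation $\delta_\alpha$, $\delta_\alpha(x)=\frac{d}{dt}\alpha_t(x)|_{t=0}$, defined on the dense *-subalgebra $D(\delta_\alpha)$ of all $x$ for which the derivative exists in norm. $\alpha$ is approximately inner if there is a sequence $(h_n)$ of self-adjoint elements of $A$ such that $\alpha_t(x)=\lim_n e^{ih_nt}xe^{-ih_nt}$ for every $t\in\mathbb R$ and $x\in A$ (equivalently, uniformly for $t$ in compact subsets of $\mathbb R$, for every $x\in A$). $\alpha$ is a compact flow if the closure of $\{\alpha_t : t\in\mathbb R\}$ in $\mathrm{Aut}(A)$ (topology of pointwise norm convergence) is compact. A maximal abelian $C^*$-subalgebra of $A$ is an abelian $C^*$-subalgebra not properly contained in any other abelian $C^*$-subalgebra of $A$. *)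

(* Defs.v *)
From HB Require Import structures.
From mathcomp Require Import all_boot all_order all_algebra.
From mathcomp Require Import complex.
From mathcomp Require Import all_classical all_reals all_analysis.

Set Implicit Arguments.
Unset Strict Implicit.
Unset Printing Implicit Defensive.
Import Order.TTheory GRing.Theory Num.Theory.
Import numFieldNormedType.Exports.
Local Open Scope classical_set_scope.
Local Open Scope complex_scope.
Local Open Scope ring_scope.

(* Nonzero unital C*-algebras over the complex numbers R[i]. The norm of a
   normed module over R[i] is R[i]-valued; its values are nonnegative, hence
   real. The multiplication is part of the mixin because Hierarchy Builder
   rejects a structure extending both [GRing.PzSemiRing] and
   [Num.SemiNormedZmodule]; the [algType] structure is derived from it below,
   and the generic operations [*], [1] and [^+] are used from there on. *)
HB.mixin Record isCStarAlgebra (R : realType) (A : Type)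
    & CompleteNormedModule R[i] A := {
  cstar_mul : A -> A -> A ;
  cstar_one : A ;
  star : A -> A ;
  cstar_mulA : associative cstar_mul ;
  cstar_mul1l : left_id cstar_one cstar_mul ;
  cstar_mul1r : right_id cstar_one cstar_mul ;
  cstar_mulDl : left_distributive cstar_mul +%R ;
  cstar_mulDr : right_distributive cstar_mul +%R ;
  cstar_scaleAl : forall (a : R[i]) (x y : A),
    a *: cstar_mul x y = cstar_mul (a *: x) y ;
  cstar_scaleAr : forall (a : R[i]) (x y : A),
    a *: cstar_mul x y = cstar_mul x (a *: y) ;
  cstar_one_neq0 : cstar_one != 0 ;
  starK : involutive star ;
  starD : {morph star : x y / x + y} ;
  starZ : forall (a : R[i]) (x : A), star (a *: x) = a^* *: star x ;
  cstar_starM : forall x y : A,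
    star (cstar_mul x y) = cstar_mul (star y) (star x) ;
  cstar_norm_mul_le : forall x y : A, `|cstar_mul x y| <= `|x| * `|y| ;
  cstar_norm_star_mul : forall x : A, `|cstar_mul (star x) x| = `|x| ^+ 2
}.

#[short(type="cstarAlgType")]
HB.structure Definition CStarAlgebra (R : realType) :=
  {A of CompleteNormedModule R[i] A & isCStarAlgebra R A}.

HB.instance Definition _ (R : realType) (A : cstarAlgType R) :=
  GRing.Zmodule_isNzRing.Build A cstar_mulA cstar_mul1l cstar_mul1r
    cstar_mulDl cstar_mulDr cstar_one_neq0.
HB.instance Definition _ (R : realType) (A : cstarAlgType R) :=
  GRing.Lmodule_isLalgebra.Build R[i] A cstar_scaleAl.
HB.instance Definition _ (R : realType) (A : cstarAlgType R) :=
  GRing.Lalgebra_isAlgebra.Build R[i] A cstar_scaleAr.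


Section CStarAlgebraTheory.
Context {R : realType} {A : cstarAlgType R}.
Implicit Types x y : A.

Lemma starM x y : star (x * y) = star y * star x.
Proof. exact: cstar_starM. Qed.

Lemma norm_mul_le x y : `|x * y| <= `|x| * `|y|.
Proof. exact: cstar_norm_mul_le. Qed.

Lemma norm_star_mul x : `|star x * x| = `|x| ^+ 2.
Proof. exact: cstar_norm_star_mul. Qed.

End CStarAlgebraTheory.

Definition separable (T : topologicalType) : Prop :=
  exists2 D : set T, countable D & dense D.

Section CStarAlgebras.
Context {R : realType}.
Implicit Type A : cstarAlgType R.

Record closed_ideal A (I : set A) : Prop := ClosedIdeal {
  closed_ideal0 : I 0 ;
  closed_idealD : forall x y, I x -> I y -> I (x + y) ;
  closed_idealZ : forall (a : R[i]) x, I x -> I (a *: x) ;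
  closed_idealMl : forall x y, I y -> I (x * y) ;
  closed_idealMr : forall x y, I x -> I (x * y) ;
  closed_ideal_closed : closed I
}.

Definition simple_cstar A : Prop :=
  forall I : set A, closed_ideal I -> I = [set 0] \/ I = setT.

(* A C*-subalgebra need not contain the unit of [A]. *)
Record cstar_subalgebra A (B : set A) : Prop := CStarSubalgebra {
  cstar_subalgebra0 : B 0 ;
  cstar_subalgebraD : forall x y, B x -> B y -> B (x + y) ;
  cstar_subalgebraZ : forall (a : R[i]) x, B x -> B (a *: x) ;
  cstar_subalgebraM : forall x y, B x -> B y -> B (x * y) ;
  cstar_subalgebra_star : forall x, B x -> B (star x) ;
  cstar_subalgebra_closed : closed B
}.

Definition abelian_cstar_subalgebra A (B : set A) : Prop :=
  cstar_subalgebra B /\ (forall x y, B x -> B y -> x * y = y * x).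

Definition maximal_abelian_cstar_subalgebra A (B : set A) : Prop :=
  abelian_cstar_subalgebra B /\
  (forall B' : set A, abelian_cstar_subalgebra B' -> ~ (B `<` B')).

Record star_automorphism A (f : A -> A) : Prop := StarAutomorphism {
  star_automorphism_linear : linear f ;
  star_automorphism_mul : monoid_morphism f ;
  star_automorphism_star : {morph f : x / star x} ;
  star_automorphism_bij : bijective f
}.

(* As a subset of [{ptws A -> A}], its associated type carries the topology
   of pointwise norm convergence. *)
Definition Aut A : set {ptws A -> A} := [set f | star_automorphism f].
Arguments Aut : clear implicits.

Definition aut_fun A (f : Aut A) : A -> A := set_val f.

Record is_flow A (alpha : R -> Aut A) : Prop := IsFlow {
  flow0 : forall x, aut_fun (alpha 0) x = x ;
  flowD : forall s t x,
    aut_fun (alpha (s + t)) x = aut_fun (alpha s) (aut_fun (alpha t) x) ;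
  flow_continuous : forall x, continuous (fun t : R => aut_fun (alpha t) x)
}.

Definition flow_quotient A (alpha : R -> Aut A) (x : A) (t : R) : A :=
  (t%:C)^-1 *: (aut_fun (alpha t) x - x).

Definition generator_domain A (alpha : R -> Aut A) : set A :=
  [set x | cvg (flow_quotient alpha x t @[t --> (0 : R)^'])].

(* Only meaningful on [generator_domain alpha]. *)
Definition generator A (alpha : R -> Aut A) (x : A) : A :=
  lim (flow_quotient alpha x t @[t --> (0 : R)^']).

Definition cstar_exp A (a : A) : A :=
  limn (series (fun k : nat => (k`!%:R : R[i])^-1 *: a ^+ k)).

Definition approximately_inner A (alpha : R -> Aut A) : Prop :=
  exists h : nat -> A,
    (forall n, star (h n) = h n) /\
    (forall (t : R) (x : A),
       cstar_exp (('i * t%:C) *: h n) * x * cstar_exp (- (('i * t%:C) *: h n))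
         @[n --> \oo] --> aut_fun (alpha t) x).

Definition compact_flow A (alpha : R -> Aut A) : Prop :=
  compact (closure (range alpha)).

End CStarAlgebras.
Arguments Aut {R} A.

(* Main.v *)
(* By Zorn's lemma take a maximal commuting set [S] of self-adjoint fixed points
   of the flow, and let [C] be its commutant in [A]. The fixed points in [C]
   commute with all of [C], so it suffices that every point of [C] is fixed:
   [C] is then a maximal abelian C*-subalgebra, on which the generator vanishes.
   The orbits being relatively compact, [C] is the closed span of the
   eigenvectors [alpha_t x = e^{ipt} x] it contains. For such an [x] the elements
   [x^* x] and [x x^*] are fixed, hence commute with [x], and this forces [x] to
   be normal. A nonzero normal eigenvector has [p = 0]: let [h_n] implement the
   flow approximately and let [z_n] be unit approximate eigenvectors of [h_n] at
   the top of its spectrum. Multiplying by an eigenvector [b] of frequency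
   [q > 0] raises the energy by [q], so [b z_n -> 0]. If [p > 0] then for every
   eigenvector [a] the product [x^(2^k) a] has positive frequency for [k] large,
   so [x^(2^k) a z_n -> 0], and [x a z_n -> 0] as [x] is normal. Hence [x] lies
   in the proper closed ideal of the [y] with [y a z_n -> 0] for all [a], which
   is zero by simplicity. *)
Require Import Defs.
From mathcomp Require Import all_boot all_order all_algebra.
From mathcomp Require Import complex.
From mathcomp Require Import all_classical all_reals all_analysis.
From mathcomp Require Import ring lra.

Set Implicit Arguments.
Unset Strict Implicit.
Unset Printing Implicit Defensive.
Import Order.TTheory GRing.Theory Num.Theory.
Import numFieldNormedType.Exports.
Local Open Scope classical_set_scope.
Local Open Scope complex_scope.
Local Open Scope ring_scope.

(** The norms of the [h_n] may tend to infinity, and nothing controls the commutator of an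
    eigenvector [b] with [h_n]. Baire's theorem makes the convergence of the inner flows on [b]
    uniform on compact time intervals. Averaging [b] over a long interval then gives [y] near [b]
    with [h_n y - y h_n] near [q y], at an error free of [nrm h_n]. The vectors [z_n] are elements
    of [A], acted on by left multiplication, and energy is measured by the lower bound
    [q * nrm y <= nrm (h_n y - (M + q) y)].

    Spectral projections of the flow are replaced by finite sums: the orbit is sampled on a fine
    grid, averaged against characters of a finite cyclic group, and the averages pass to the limit
    along an ultrafilter. Total boundedness gives the return times of the orbit a positive density,
    so the number of averages needed for a given accuracy does not grow with the grid, and the
    approximation survives in the limit.

    The [y] with [y z_n -> 0] form only a left ideal, whence the extra factor [a]. Powers of the
    form [2^k] occur because normality allows one squaring of [x] to be undone at a time. *)

Section RealNorm.
Context {R : realType}.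

(** Real values make the order total and bring norm estimates within reach of [lra] and [nra]. *)
Definition nrm (V : normedZmodType R[i]) (x : V) : R := complex.Re `|x|.

Section Normed.
Variable V : normedZmodType R[i].
Implicit Types x y z : V.

Lemma nrmE x : `|x| = (nrm x)%:C.
Proof. by rewrite /nrm RRe_real// ger0_real. Qed.

Lemma nrm_ge0 x : 0 <= nrm x.
Proof. by rewrite -ler0c -nrmE. Qed.

Lemma nrm0 : nrm (0 : V) = 0.
Proof. by rewrite /nrm normr0. Qed.

Lemma nrm_eq0 x : nrm x = 0 -> x = 0.
Proof. by move=> x0; apply/eqP; rewrite -normr_eq0 nrmE x0. Qed.

Lemma nrmN x : nrm (- x) = nrm x.
Proof. by rewrite /nrm normrN. Qed.

Lemma nrmD x y : nrm (x + y) <= nrm x + nrm y.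
Proof. by rewrite -lecR rmorphD /= -!nrmE ler_normD. Qed.

Lemma nrmB x y : nrm (x - y) <= nrm x + nrm y.
Proof. by rewrite -(nrmN y) nrmD. Qed.

Lemma nrm_distC x y : nrm (x - y) = nrm (y - x).
Proof. by rewrite -nrmN opprB. Qed.

Lemma nrm_dist_triangle y x z : nrm (x - z) <= nrm (x - y) + nrm (y - z).
Proof. by have := nrmD (x - y) (y - z); rewrite addrA subrK. Qed.

Lemma nrm_le_dist y x : nrm x <= nrm y + nrm (x - y).
Proof. by have := nrmD y (x - y); rewrite addrC subrK. Qed.

Lemma nrm_sum (I : Type) (r : seq I) (P : pred I) (F : I -> V) :
  nrm (\sum_(i <- r | P i) F i) <= \sum_(i <- r | P i) nrm (F i).
Proof.
elim/big_ind2 : _ => [|x a y b xa yb|i _ //]; first by rewrite nrm0.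
by rewrite (le_trans (nrmD _ _))// lerD.
Qed.

End Normed.

Implicit Types a b : R[i].

Lemma nrm_scalarM a b : nrm (a * b) = nrm a * nrm b.
Proof. by apply: complexI; rewrite rmorphM /= -!nrmE normrM. Qed.

Lemma nrm_scalarX a n : nrm (a ^+ n) = nrm a ^+ n.
Proof. by apply: complexI; rewrite rmorphXn /= -!nrmE normrX. Qed.

Lemma nrm_real (t : R) : nrm t%:C = `|t|.
Proof. by apply: complexI; rewrite -nrmE normc_def /= expr0n addr0 sqrtr_sqr. Qed.

Lemma nrm_i : nrm 'i = 1.
Proof. by rewrite /nrm normc_def /= expr0n expr1n add0r sqrtr1. Qed.

Lemma nrm_nat n : nrm (n%:R : R[i]) = n%:R.
Proof. by rewrite -(rmorph_nat (real_complex R)) nrm_real normr_nat. Qed.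

Lemma nrm_scalarV a : nrm a^-1 = (nrm a)^-1.
Proof. by apply: complexI; rewrite fmorphV /= -!nrmE normfV. Qed.

Lemma sqr_nrm a : nrm a ^+ 2 = complex.Re a ^+ 2 + complex.Im a ^+ 2.
Proof. by apply: complexI; rewrite rmorphXn /= -nrmE add_Re2_Im2. Qed.

Lemma mulJ_sqr_nrm a : a * a^* = (nrm a ^+ 2)%:C.
Proof.
rewrite sqr_nrm; case: a => x y /=; apply/eqP; rewrite eq_complex /=.
by apply/andP; split; apply/eqP; ring.
Qed.

Lemma conjc_nrm1 a : nrm a = 1 -> a^* = a^-1.
Proof.
move=> a1; have aV : a * a^* = 1 by rewrite mulJ_sqr_nrm a1 expr1n.
have a0 : a != 0 by apply/eqP => a0; move: a1; rewrite a0 nrm0; lra.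
by apply: (mulfI a0); rewrite aV mulfV.
Qed.

Lemma Re_le_nrm a : `|complex.Re a| <= nrm a.
Proof.
rewrite -ler_sqr ?nnegrE ?nrm_ge0// real_normK ?num_real// sqr_nrm.
by rewrite lerDl sqr_ge0.
Qed.

Lemma Im_le_nrm a : `|complex.Im a| <= nrm a.
Proof.
rewrite -ler_sqr ?nnegrE ?nrm_ge0// real_normK ?num_real// sqr_nrm.
by rewrite lerDr sqr_ge0.
Qed.

Lemma nrm_le_ReIm a : nrm a <= `|complex.Re a| + `|complex.Im a|.
Proof.
rewrite {1}[a]complexE (le_trans (nrmD _ _))// nrm_scalarM nrm_i mul1r.
by rewrite !nrm_real.
Qed.

Lemma nrmZ (V : normedModType R[i]) a (x : V) : nrm (a *: x) = nrm a * nrm x.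
Proof. by apply: complexI; rewrite rmorphM /= -!nrmE normrZ. Qed.

Lemma cvg_nrmP (V : normedModType R[i]) (T : Type) (F : set_system T)
    (FF : Filter F) (f : T -> V) (l : V) :
  f x @[x --> F] --> l <->
  forall e : R, 0 < e -> \forall x \near F, nrm (l - f x) < e.
Proof.
rewrite cvgrPdist_lt; split => [fl e e0|fl e e0].
  have := fl e%:C; rewrite ltcR => /(_ e0).
  by apply: filterS => x; rewrite nrmE ltcR.
(* A positive element of [R[i]] has imaginary part 0. *)
move: e e0 => [e e'] /[!ltcE]/= /andP[/eqP -> e0].
by have := fl _ e0; apply: filterS => x; rewrite nrmE ltcR.
Qed.

Lemma closed_nrm (V : normedModType R[i]) (B : set V) :
  (forall x, (forall e : R, 0 < e -> exists2 y, B y & nrm (x - y) < e) -> B x) ->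
  closed B.
Proof.
move=> Bx x cBx; apply: Bx => e e0.
have [|y []] := cBx (ball x e%:C); first by apply: nbhsx_ballx; rewrite ltcR.
by move=> By; rewrite -ball_normE /= nrmE ltcR; exists y.
Qed.

Lemma nrm_closed (V : normedModType R[i]) (B : set V) : closed B ->
  forall x, (forall e : R, 0 < e -> exists2 y, B y & nrm (x - y) < e) -> B x.
Proof.
move=> cB x Bx; apply: cB => U /nbhs_ballP[e /= e0 xU].
move: e e0 xU => [e e'] /[!ltcE]/= /andP[/eqP -> e0] xU.
have [y By xy] := Bx _ e0; exists y; split => //; apply: xU.
by rewrite -ball_normE /= nrmE ltcR.
Qed.

Lemma cauchy_nrm_cvg (V : completeNormedModType R[i]) (T : Type)
    (F : set_system T) (FF : ProperFilter F) (f : T -> V) :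
  (forall e : R, 0 < e -> exists y, \forall x \near F, nrm (y - f x) < e) ->
  exists l, forall e : R, 0 < e -> \forall x \near F, nrm (l - f x) < e.
Proof.
move=> fe; suff fc : cvg (f x @[x --> F]).
  by exists (lim (f x @[x --> F])); apply/cvg_nrmP.
apply: cauchy_cvg; apply: cauchy_exP => e e0.
move: e e0 => [e e'] /[!ltcE]/= /andP[/eqP -> e0].
have [y ye] := fe _ e0; exists y; near=> x.
by rewrite -ball_normE /= nrmE ltcR; near: x.
Unshelve. all: by end_near. Qed.

Definition cis (t : R) : R[i] := cos t +i* sin t.

Lemma cis0 : cis 0 = 1.
Proof. by rewrite /cis cos0 sin0. Qed.

Lemma cisD s t : cis (s + t) = cis s * cis t.
Proof. by rewrite /cis cosD sinD; congr (_ +i* _); ring. Qed.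

Lemma nrm_cis t : nrm (cis t) = 1.
Proof.
apply/eqP; rewrite -(@eqrXn2 _ 2)// ?nrm_ge0// expr1n sqr_nrm /=.
by rewrite cos2Dsin2.
Qed.

Lemma cis_neq0 t : cis t != 0.
Proof. by apply/eqP => t0; have := nrm_cis t; rewrite t0 nrm0; lra. Qed.

Lemma conj_cis t : (cis t)^* = cis (- t).
Proof. by rewrite /cis cosN sinN. Qed.

Lemma cisN t : cis (- t) = (cis t)^-1.
Proof. by rewrite -conj_cis conjc_nrm1// nrm_cis. Qed.

Lemma cisMn t n : cis (t *+ n) = cis t ^+ n.
Proof. by elim: n => [|n IH]; rewrite ?mulr0n ?cis0// mulrS cisD IH exprS. Qed.

End RealNorm.

(** * Norm and involution in a C*-algebra *)

Section CStarNorm.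
Context {R : realType} {A : cstarAlgType R}.
Implicit Types x y : A.

Lemma nrmM x y : nrm (x * y) <= nrm x * nrm y.
Proof. by rewrite -lecR rmorphM /= -!nrmE; exact: norm_mul_le. Qed.

Lemma nrm_star_mul x : nrm (star x * x) = nrm x ^+ 2.
Proof. by apply: complexI; rewrite rmorphXn /= -!nrmE norm_star_mul. Qed.

Lemma nrm_star x : nrm (star x) = nrm x.
Proof.
have le_star y : nrm y <= nrm (star y).
  have [->|y0] := eqVneq (nrm y) 0; first exact: nrm_ge0.
  have : nrm y ^+ 2 <= nrm (star y) * nrm y by rewrite -nrm_star_mul nrmM.
  by rewrite expr2 ler_pM2r// lt_neqAle eq_sym y0 nrm_ge0.
by apply/eqP; rewrite eq_le le_star andbT -{2}(starK x) le_star.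
Qed.

Lemma star0 : star (0 : A) = 0.
Proof. by apply: (addrI (star 0)); rewrite -starD !addr0. Qed.

Lemma star1 : star (1 : A) = 1.
Proof. by rewrite -[RHS]starK -[star 1 in RHS]mul1r starM starK mul1r. Qed.

Lemma starN x : star (- x) = - star x.
Proof. by apply: (addrI (star x)); rewrite -starD !subrr star0. Qed.

Lemma starB x y : star (x - y) = star x - star y.
Proof. by rewrite starD starN. Qed.

Lemma starX x n : star (x ^+ n) = star x ^+ n.
Proof. by elim: n => [|n IH]; rewrite ?star1// exprS exprSr starM IH. Qed.

Lemma nrm1 : nrm (1 : A) = 1.
Proof.
have := nrm_star_mul 1; rewrite star1 mulr1 expr2 => n1.
have n0 : nrm (1 : A) != 0.
  by apply/eqP => /nrm_eq0 /eqP; rewrite oner_eq0.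
by apply: (mulfI n0); rewrite -n1 mulr1.
Qed.

Lemma nrmX x n : nrm (x ^+ n) <= nrm x ^+ n.
Proof.
elim: n => [|n IH]; first by rewrite !expr0 nrm1.
by rewrite !exprS (le_trans (nrmM _ _))// ler_wpM2l// nrm_ge0.
Qed.

Lemma nrm_sqr_selfadj x : star x = x -> nrm (x ^+ 2) = nrm x ^+ 2.
Proof. by move=> xx; rewrite -nrm_star_mul xx. Qed.

Lemma nrm_unitary_mull u x : star u * u = 1 -> nrm (u * x) = nrm x.
Proof.
move=> uu; apply/eqP; rewrite -(@eqrXn2 _ 2)// ?nrm_ge0//.
by rewrite -!nrm_star_mul starM -mulrA (mulrA (star u)) uu mul1r.
Qed.

Lemma nrm_unitary_mulr u x : u * star u = 1 -> nrm (x * u) = nrm x.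
Proof.
by move=> uu; rewrite -nrm_star starM nrm_unitary_mull ?starK// nrm_star.
Qed.

(* [star x * star x * x * x = star x * x * (star x * x)] for normal [x]. *)
Lemma nrm_normal_mul_mul x y : star x * x = x * star x ->
  nrm (x * (x * y)) = nrm (star x * (x * y)).
Proof.
move=> xx; apply/eqP; rewrite -(@eqrXn2 _ 2)// ?nrm_ge0//.
rewrite -!nrm_star_mul !starM !starK; apply/eqP; congr nrm.
by rewrite -!mulrA; congr (_ * (_ * _)); rewrite !mulrA xx.
Qed.

End CStarNorm.

(** * Exponentials in a C*-algebra *)

Section ExpPartialSums.
Variables (K : numFieldType) (B : algType K).
Implicit Types a b : B.

Definition exp_term a k : B := (k`!%:R : K)^-1 *: a ^+ k.

Lemma exp_termD a b k : GRing.comm a b ->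
  exp_term (a + b) k = \sum_(0 <= i < k.+1) exp_term a (k - i) * exp_term b i.
Proof.
move=> ab; rewrite /exp_term exprDn_comm// scaler_sumr big_mkord.
apply: eq_bigr => i _; rewrite -scalerAl -scalerAr scalerA -[_ *+ 'C(k, i)]scaler_nat scalerA.
congr (_ *: _); have ik : (i <= k)%N by rewrite -ltnS.
rewrite -(bin_fact ik) !natrM !invfM.
have u m : (m`!%:R : K) != 0 by rewrite pnatr_eq0 -lt0n fact_gt0.
have v : ('C(k, i)%:R : K) != 0 by rewrite pnatr_eq0 -lt0n bin_gt0.
by rewrite [_ * (_ / _)]mulrC -mulrA mulVf// mulr1 mulrC.
Qed.

(** The remainder consists of the terms of the Cauchy product beyond the antidiagonal. Over a
    general algebra, the identity serves in [A] and, read backwards, in [R], where the same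
    remainder for the norms tends to 0. *)
Lemma exp_partial_sumD a b n : GRing.comm a b ->
  series (exp_term a) n * series (exp_term b) n - series (exp_term (a + b)) n =
  \sum_(0 <= i < n) \sum_(n - i <= j < n) exp_term a j * exp_term b i.
Proof.
move=> ab; rewrite /series /=.
have -> : \sum_(0 <= k < n) exp_term (a + b) k =
    \sum_(0 <= i < n) \sum_(0 <= j < n - i) exp_term a j * exp_term b i.
  under eq_bigr do rewrite exp_termD//.
  transitivity (\sum_(0 <= k < n) \sum_(0 <= i < n | (i < k.+1)%N)
      exp_term a (k - i) * exp_term b i).
    by apply: eq_big_nat => k /andP[_ kn]; rewrite (big_nat_widen _ _ n).
  rewrite (exchange_big_dep_nat xpredT)//=; apply: eq_big_nat => i /andP[_ lt_in].
  rewrite (big_cat_nat (leq0n i) (ltnW lt_in))/= big_nat_cond big1 ?add0r.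
    rewrite -{1}(add0n i) big_addn big_nat_cond [RHS]big_nat_cond.
    apply: eq_big => [j|j _]; last by rewrite addnK.
    by rewrite ltnS leq_addl andbT.
  by move=> j /andP[/andP[_ ji]]; rewrite ltnS leqNgt ji.
rewrite mulr_sumr -sumrB; apply: eq_big_nat => i /andP[_ lt_in].
rewrite mulr_suml (big_cat_nat (leq0n (n - i)%N) (leq_subr i n)) /=.
by rewrite addrAC subrr add0r.
Qed.

End ExpPartialSums.

Section CStarExp.
Context {R : realType} {A : cstarAlgType R}.
Implicit Types a b h : A.

Lemma nrm_exp_term a k : nrm (exp_term a k) <= exp_term (nrm a : R^o) k.
Proof.
rewrite /exp_term nrmZ nrm_scalarV nrm_nat [X in _ <= X]/(_ *: _)/=.
by rewrite ler_wpM2l ?invr_ge0// nrmX.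
Qed.

Lemma nrm_exp_sumB a m n : (m <= n)%N ->
  nrm (series (exp_term a) n - series (exp_term a) m) <=
  series (exp_term (nrm a : R^o)) n - series (exp_term (nrm a : R^o)) m.
Proof.
move=> mn; rewrite !sub_series mn (le_trans (nrm_sum _ _ _))//.
by apply: ler_sum => k _; exact: nrm_exp_term.
Qed.

Lemma exp_term_real (r : R) : exp_term (r : R^o) = exp_coeff r.
Proof. by apply/funext => k; rewrite /exp_coeff /= /exp_term mulrC. Qed.

Lemma exp_sum_cvg (r : R) : series (exp_term (r : R^o)) @ \oo --> expR r.
Proof. by rewrite exp_term_real; exact: is_cvg_series_exp_coeff. Qed.

Lemma exp_sum_le (r : R) n : 0 <= r -> series (exp_term (r : R^o)) n <= expR r.
Proof.
move=> r0; have /cvg_lim <- // := exp_sum_cvg (r:=r).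
apply: nondecreasing_cvgn_le; last by apply/cvg_ex; eexists; exact: exp_sum_cvg.
apply/nondecreasing_seqP => m; rewrite /series /= big_nat_recr//= lerDl.
by rewrite exp_term_real exp_coeff_ge0.
Qed.

Lemma cstar_exp_cvg a (e : R) : 0 < e ->
  \forall n \near \oo, nrm (cstar_exp a - series (exp_term a) n) < e.
Proof.
move=> e0.
have [d d0|l al] := @cauchy_nrm_cvg _ _ _ \oo _ (series (exp_term a)).
  have /cvgrPdist_lt/(_ (d / 2)) := exp_sum_cvg (r:=nrm a).
  case; first by lra.
  move=> N _ Nd; exists (series (exp_term a) N); exists N => // n /= Nn.
  rewrite nrm_distC (le_lt_trans (nrm_exp_sumB _ Nn))//.
  have := Nd _ (leqnn N); have := Nd _ Nn; rewrite !ltr_distl.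
  by lra.
have -> : cstar_exp a = l; last exact: al.
by apply: cvg_lim; [exact: norm_hausdorff|apply/cvg_nrmP].
Qed.

Lemma cstar_exp_nrm_le a b (c : R) :
  (\forall n \near \oo, nrm (b - series (exp_term a) n) <= c) ->
  nrm (b - cstar_exp a) <= c.
Proof.
move=> bc; apply/ler_addgt0Pr => e e0; near \oo => n.
rewrite (le_trans (nrm_dist_triangle (series (exp_term a) n) _ _))// lerD//.
  by near: n.
by rewrite nrm_distC ltW//; near: n; exact: cstar_exp_cvg.
Unshelve. all: by end_near. Qed.

Lemma nrm_dist_le0 (V : normedZmodType R[i]) (x y : V) :
  (forall e : R, 0 < e -> nrm (x - y) <= e) -> x = y.
Proof.
move=> xy; apply/eqP; rewrite -subr_eq0; apply/eqP/nrm_eq0/eqP.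
rewrite eq_le nrm_ge0 andbT; apply/ler_addgt0Pr => e e0.
by rewrite add0r xy.
Qed.

Lemma cstar_expD a b : GRing.comm a b ->
  cstar_exp (a + b) = cstar_exp a * cstar_exp b.
Proof.
move=> ab; apply/esym/nrm_dist_le0 => e e0; apply: cstar_exp_nrm_le.
set r := nrm a; set s := nrm b.
(* An error [d] in each factor of the product costs [d * (expR s + 1) + expR r * d = e / 4]. *)
have d0 : 0 < e / (4 * (expR r + expR s + 1)).
  by rewrite divr_gt0// mulr_gt0// addr_gt0// addr_gt0// expR_gt0.
set d := e / _ in d0.
have lim0 : series (exp_term (r : R^o)) n * series (exp_term (s : R^o)) n -
    series (exp_term ((r + s : R) : R^o)) n @[n --> \oo] --> 0.
  rewrite -[0](subrr (expR (r + s))) {1}expRD.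
  by apply: cvgB; [apply: cvgM|]; exact: exp_sum_cvg.
near=> n.
have xu : nrm (cstar_exp a - series (exp_term a) n) < d.
  by near: n; exact: cstar_exp_cvg.
have yv : nrm (cstar_exp b - series (exp_term b) n) < d.
  by near: n; exact: cstar_exp_cvg.
have yv1 : nrm (cstar_exp b - series (exp_term b) n) < 1.
  by near: n; exact: cstar_exp_cvg.
have realD_le : series (exp_term (r : R^o)) n * series (exp_term (s : R^o)) n -
    series (exp_term ((r + s : R) : R^o)) n <= e / 2.
  rewrite (le_trans (ler_norm _))// -[`|_|]normrN -[X in `|X|]sub0r ltW//.
  by near: n; move/cvgrPdist_lt: lim0; apply; lra.
set x := cstar_exp a in xu *; set y := cstar_exp b in yv yv1 *.
set u := series (exp_term a) n in xu *; set v := series (exp_term b) n in yv yv1 *.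
have sum_le (c : A) m : nrm (series (exp_term c) m) <= expR (nrm c).
  rewrite (le_trans _ (exp_sum_le m (nrm_ge0 c)))// (le_trans (nrm_sum _ _ _))//.
  by apply: ler_sum => k _; exact: nrm_exp_term.
have y_le : nrm y <= expR s + 1.
  by have := sum_le b n; have := nrm_le_dist v y; rewrite -/s -/v; lra.
have prod_le : nrm (x * y - u * v) <= e / 2.
  have -> : x * y - u * v = (x - u) * y + u * (y - v).
    by rewrite mulrBl mulrBr addrA subrK.
  rewrite (le_trans (nrmD _ _))//.
  have h1 : nrm ((x - u) * y) <= d * (expR s + 1).
    by rewrite (le_trans (nrmM _ _))// ler_pM// ?nrm_ge0// ltW.
  have h2 : nrm (u * (y - v)) <= expR r * d.
    by rewrite (le_trans (nrmM _ _))// ler_pM// ?nrm_ge0// ?sum_le// ltW.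
  rewrite (le_trans (lerD h1 h2))// (_ : _ + _ = e / 4)//; first by lra.
  rewrite /d; field; have := expR_gt0 r; have := expR_gt0 s.
  by move=> s0 r0; rewrite gt_eqF// addr_gt0// addr_gt0.
have sumD_le : nrm (u * v - series (exp_term (a + b)) n) <= e / 2.
  rewrite exp_partial_sumD//.
  have le1 : nrm (\sum_(0 <= i < n) \sum_(n - i <= j < n)
      exp_term a j * exp_term b i) <= \sum_(0 <= i < n) \sum_(n - i <= j < n)
      exp_term (r : R^o) j * exp_term (s : R^o) i.
    rewrite (le_trans (nrm_sum _ _ _))//; apply: ler_sum => i _.
    rewrite (le_trans (nrm_sum _ _ _))//; apply: ler_sum => j _.
    by rewrite (le_trans (nrmM _ _))// ler_pM ?nrm_ge0// nrm_exp_term.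
  by rewrite (le_trans le1)// -exp_partial_sumD//; exact: mulrC.
rewrite (le_trans (nrm_dist_triangle (u * v) _ _))//.
by rewrite (le_trans (lerD prod_le sumD_le))//; lra.
Unshelve. all: by end_near. Qed.

Lemma cstar_exp0 : cstar_exp (0 : A) = 1.
Proof.
apply/esym/nrm_dist_le0 => e e0; apply: cstar_exp_nrm_le.
exists 1%N => // n /= n1; rewrite /series /= big_ltn// big_nat big1; last first.
  by move=> [//|k] _; rewrite /exp_term expr0n scaler0.
by rewrite /exp_term fact0 invr1 scale1r expr0 addr0 subrr nrm0 ltW.
Qed.

Lemma star_cstar_exp a : star (cstar_exp a) = cstar_exp (star a).
Proof.
apply/nrm_dist_le0 => e e0; apply: cstar_exp_nrm_le; near=> n.
have -> : series (exp_term (star a)) n = star (series (exp_term a) n).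
  rewrite /series /= (big_morph _ (@starD _ A) (@star0 _ A)).
  apply: eq_bigr => k _; rewrite /exp_term starZ starX; congr (_ *: _).
  by rewrite fmorphV rmorph_nat.
rewrite -starB nrm_star ltW//; near: n; exact: cstar_exp_cvg.
Unshelve. all: by end_near. Qed.

(** Shifting the index by two and using [k! <= (k + 2)!] bounds the tail of the series by
    [nrm a ^+ 2] times the whole series. *)
Lemma nrm_cstar_exp_sub1 a : nrm (1 + a - cstar_exp a) <= nrm a ^+ 2 * expR (nrm a).
Proof.
apply: cstar_exp_nrm_le; exists 2%N => // n /= n2.
rewrite nrm_distC; have -> : 1 + a = series (exp_term a) 2.
  rewrite /series /= !big_nat_recr//= big_geq// add0r /exp_term fact0 invr1.
  by rewrite !scale1r expr0 expr1.
rewrite (le_trans (nrm_exp_sumB _ n2))// sub_series n2.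
rewrite (le_trans _ (ler_wpM2l (sqr_ge0 _) (exp_sum_le n (nrm_ge0 a))))//.
set r := nrm a; have r0 : 0 <= r := nrm_ge0 a.
rewrite /series /= mulr_sumr -{1}(add0n 2%N) big_addn.
rewrite [X in _ <= X](big_cat_nat (leq0n (n - 2)%N) (leq_subr 2 n)) /=.
rewrite -[X in X <= _]addr0 lerD//; last first.
  by apply: sumr_ge0 => k _; rewrite exp_term_real mulr_ge0 ?exprn_ge0// exp_coeff_ge0.
apply: ler_sum => k _; rewrite /exp_term [X in X <= _]/(_ *: _)/=.
rewrite exprD mulrA [X in X <= _]mulrC -!/(_ *: _) ler_wpM2l ?exprn_ge0//.
rewrite ler_wpM2r ?exprn_ge0// lef_pV2 ?posrE ?ltr0n ?fact_gt0// ler_nat.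
by rewrite addn2 !factS mulnA leq_pmull// muln_gt0.
Qed.

End CStarExp.

(** * Approximate eigenvectors at the top of the spectrum *)

Section TopApproximateEigenvector.
Context {R : realType} {A : cstarAlgType R}.
Implicit Types a b h x y z : A.

(* [(1 + i b)^2 - (1 - i b)^2 = 4 i b], and [1 + i b] and [1 - i b] are normal
   with [(1 - i b) (1 + i b) = 1 + b^2]. *)
Lemma nrm_mul2_le b y : star b = b ->
  2 * nrm (b * y) <= nrm ((1 + b ^+ 2) * y).
Proof.
move=> bb; pose u := 1 + 'i *: b; pose v := 1 - 'i *: b.
have vE : star u = v.
  rewrite /u /v starD star1 starZ bb; congr (_ + _).
  by rewrite -scaleNr; congr (_ *: _); apply/eqP; rewrite eq_complex /= oppr0 !eqxx.
have uE : star v = u by rewrite -vE starK.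
have ii : ('i * 'i : R[i]) = -1 by rewrite -expr2 sqr_i.
have cc : ('i *: b) * ('i *: b) = - b ^+ 2.
  by rewrite -scalerAl -scalerAr scalerA ii scaleN1r expr2.
have uv : u * v = 1 + b ^+ 2.
  by rewrite /u /v mulrBr mulr1 mulrDl mul1r cc opprB addrACA subrr addr0.
have vu : v * u = 1 + b ^+ 2.
  by rewrite /u /v mulrDr mulr1 mulrBl mul1r cc opprK addrA subrK.
have u2 : nrm (u * (u * y)) = nrm ((1 + b ^+ 2) * y).
  by rewrite nrm_normal_mul_mul vE ?vu// mulrA vu.
have v2 : nrm (v * (v * y)) = nrm ((1 + b ^+ 2) * y).
  by rewrite nrm_normal_mul_mul uE ?uv// mulrA uv.
have uv4 : u * (u * y) - v * (v * y) = (4%:R * 'i) *: (b * y).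
  rewrite !mulrA -mulrBl -!expr2 /u /v [1 + _]addrC -(sqrrN (1 - _)) opprB.
  rewrite sqrrD1 sqrrB1 opprD opprB addrACA subrr addr0 [_ + _ *+ 2]addrC.
  by rewrite addrACA subrr addr0 -mulrnDr -scaler_nat -!scalerAl scalerA.
have : nrm ((4%:R * 'i) *: (b * y)) <= 2 * nrm ((1 + b ^+ 2) * y).
  by rewrite -uv4 (le_trans (nrmB _ _))// u2 v2; lra.
rewrite nrmZ nrm_scalarM nrm_i mulr1 nrm_nat; lra.
Qed.

(** The geometric sum of the first [2 ^ k] even powers of [a], in factored form: each factor is
    [1 + b ^+ 2] with [b] a power of [a], as [nrm_mul2_le] requires. *)
Fixpoint dyadic_prod a k : A :=
  if k is k'.+1 then (1 + a ^+ (2 ^ k'.+1)) * dyadic_prod a k' else 1.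

Lemma dyadic_prod_comm a b k : GRing.comm a b -> GRing.comm (dyadic_prod a k) b.
Proof.
move=> ab; elim: k => [|k IH] /=; first exact/commr_sym/commr1.
apply/commr_sym/commrM; last exact/commr_sym.
by apply: commrD; [exact: commr1|apply: commrX; exact/commr_sym].
Qed.

Lemma mul_dyadic_prod a k : (1 - a ^+ 2) * dyadic_prod a k = 1 - a ^+ (2 ^ k.+1).
Proof.
elim: k => [|k IH] /=; first by rewrite mulr1 expn1.
rewrite mulrA -[X in X * _](_ : (1 + a ^+ (2 ^ k.+1)) * (1 - a ^+ 2) = _); last first.
  apply/commr_sym/commrD; first exact: commr1.
  by apply/commrX/commr_sym/commrB; [exact: commr1|exact: commrX].
rewrite -mulrA IH mulrDl mul1r mulrBr mulr1 -exprD addnn -mul2n -expnS.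
by rewrite addrA subrK.
Qed.

(** By [nrm_mul2_le] each factor [1 + b ^+ 2] is worth at least [2 b], and the exponents of these
    [b] add up to [1 + 2 + ... + 2 ^ (k - 1)]. This gives an exponential lower bound without
    functional calculus. *)
Lemma nrm_dyadic_prod a y k : star a = a ->
  2 ^+ k * nrm (a ^+ (2 ^ k).-1 * y) <= nrm (dyadic_prod a k * y).
Proof.
move=> aa; elim: k y => [|k IH] y /=; first by rewrite expr0 !mul1r.
have b_sa : star (a ^+ (2 ^ k)) = a ^+ (2 ^ k) by rewrite starX aa.
have := nrm_mul2_le (dyadic_prod a k * y) b_sa.
rewrite -exprM -expnSr !mulrA; apply: le_trans.
rewrite exprS -mulrA ler_pM2l//.
rewrite -(dyadic_prod_comm k (_ : GRing.comm a (a ^+ (2 ^ k)))).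
  rewrite -mulrA (le_trans _ (IH _))// mulrA -exprD.
  rewrite (_ : (_.-1 + _)%N = (2 ^ k.+1).-1)//.
  by rewrite expnS mul2n -addnn -(prednK (expn_gt0 2 k)) addSn addnS.
exact: commrX.
Qed.

Lemma nrm_dyadic_power a k : star a = a -> nrm a = 1 -> nrm (a ^+ (2 ^ k)) = 1.
Proof.
move=> aa a1; elim: k => [|k IH]; first by rewrite expn0 expr1.
by rewrite expnSr exprM nrm_sqr_selfadj ?starX ?aa// IH expr1n.
Qed.

(* [M] is the maximum of the spectrum of [h]. With [N] the norm of the positive
   element [g = h + L] and [a = g / N], the witness is the normalization of
   [(1 + a) \prod_(i < k) (1 + a ^ 2 ^ i.+1)], which [1 - a] maps to
   [1 - a ^ 2 ^ k.+1]. *)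
Lemma top_approximate_eigenvector h (e : R) : star h = h -> 0 < e ->
  exists (M : R) (z : A), [/\ nrm z = 1, nrm (h * z - M%:C *: z) <= e &
    forall q y, 0 <= q -> q * nrm y <= nrm (h * y - (M + q)%:C *: y)].
Proof.
move=> hh e0.
pose L := nrm h + 1; pose g := h + L%:C *: 1; pose N := nrm g.
have gM y : g * y = h * y + L%:C *: y by rewrite mulrDl -scalerAl mul1r.
have nLZ (y : A) : nrm (L%:C *: y) = L * nrm y.
  by rewrite nrmZ nrm_real ger0_norm// addr_ge0 ?nrm_ge0.
have N0 : 0 < N.
  have := nrm_le_dist g (L%:C *: 1); rewrite nLZ nrm1 mulr1 opprD addrCA subrr.
  by rewrite addr0 nrmN /L /N; lra.
pose a := N^-1%:C *: g.
have aa : star a = a.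
  rewrite /a /g starZ starD starZ star1 hh.
  by rewrite !(_ : forall r : R, (r%:C)^* = r%:C)// => r; exact: conjc_real.
have nNV (y : A) : nrm (N^-1%:C *: y) = N^-1 * nrm y.
  by rewrite nrmZ nrm_real ger0_norm// invr_ge0 ltW.
have a1 : nrm a = 1 by rewrite nNV mulVf// gt_eqF.
have NC : (N%:C : R[i]) != 0 by apply/eqP => /complexI NC; move: N0; rewrite NC ltxx.
have gE : g = N%:C *: a by rewrite scalerA -rmorphM /= divff ?gt_eqF// scale1r.
(* The normalized witness is an eigenvector up to [N * nrm (1 - a ^+ (2 ^ k.+1)) / nrm w], which is
   at most [2 * N / 2 ^+ k]. *)
pose k := Num.bound (2 * N / e).
have kP : 2 * N <= e * 2 ^+ k.
  rewrite [e * _]mulrC -ler_pdivrMr//; apply: (@le_trans _ _ k%:R).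
    by rewrite ltW// archi_boundP// divr_ge0 ?mulr_ge0// ltW.
  by rewrite -natrX ler_nat ltnW// ltn_expl//.
pose w := (1 + a) * dyadic_prod a k.
have aw : (1 - a) * w = 1 - a ^+ (2 ^ k.+1).
  rewrite mulrA -mul_dyadic_prod; congr (_ * _).
  by rewrite mulrDr mulr1 mulrBl mul1r addrA subrK.
have w_ge : 2 ^+ k <= nrm w.
  apply: (@le_trans _ _ (nrm (dyadic_prod a k))).
    have := nrm_dyadic_prod 1 k aa; rewrite !mulr1; apply: le_trans.
    rewrite -[X in X <= _]mulr1 ler_pM2l ?exprn_gt0//.
    rewrite -(nrm_dyadic_power k aa a1) -{1}(prednK (expn_gt0 2 k)) exprS.
    by rewrite (le_trans (nrmM _ _))// a1 mul1r.
  (* The factor [1 + a] does not decrease the norm: [N (1 + a) = (N + L) + h], and [L] exceeds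
     [nrm h]. This estimate stands in for the positivity of [a]. *)
  rewrite /w; set y := dyadic_prod a k.
  have -> : (1 + a) * y = N^-1%:C *: ((N + L)%:C *: y + h * y).
    rewrite mulrDl mul1r -scalerAl gM [in RHS]rmorphD /= scalerDl !scalerDr.
    rewrite scalerA -rmorphM /= mulVf ?gt_eqF// scale1r -!addrA; congr (_ + _).
    by rewrite addrC.
  rewrite nNV ler_pdivlMl//.
  have : nrm ((N + L)%:C *: y) = (N + L) * nrm y.
    by rewrite nrmZ nrm_real ger0_norm// !addr_ge0 ?nrm_ge0.
  move: (_ *: y) => p pE; have := nrm_le_dist (p + h * y) p.
  rewrite opprD addrA subrr add0r nrmN pE mulrDl.
  have := nrmM h y; have := nrm_ge0 y; rewrite {1}/L mulrDl mul1r; lra.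
have w0 : 0 < nrm w by apply: lt_le_trans w_ge; rewrite exprn_gt0.
have nwV (y : A) : nrm ((nrm w)^-1%:C *: y) = (nrm w)^-1 * nrm y.
  by rewrite nrmZ nrm_real ger0_norm// invr_ge0 ltW.
have hE y r : h * y - (N - L + r)%:C *: y = g * y - (N + r)%:C *: y.
  rewrite gM [N - L + r]addrAC rmorphB /= scalerBl opprB addrA [in RHS]addrAC.
  by rewrite addrAC.
exists (N - L), ((nrm w)^-1%:C *: w); split.
- by rewrite nwV mulVf// gt_eqF.
- rewrite -[N - L]addr0 hE addr0 -scalerAr scalerA mulrC -scalerA -scalerBr nwV.
  have -> : g * w - N%:C *: w = - (N%:C *: ((1 - a) * w)).
    by rewrite {1}gE -scalerAl -scalerBr -scalerN mulrBl mul1r opprB.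
  rewrite nrmN nrmZ nrm_real gtr0_norm// aw ler_pdivrMl//.
  have := nrmB (1 : A) (a ^+ (2 ^ k.+1)); rewrite nrm1 nrm_dyadic_power// => le2.
  rewrite (le_trans (ler_wpM2l (ltW N0) le2))//.
  have := ler_wpM2l (ltW e0) w_ge; lra.
- move=> q y q0; rewrite hE.
  have := nrm_le_dist (g * y - (N + q)%:C *: y) (- ((N + q)%:C *: y)).
  rewrite nrmN nrmZ nrm_real ger0_norm; last by rewrite addr_ge0// ltW.
  rewrite opprB addrA addNr add0r nrmN.
  by have := nrmM g y; rewrite -/N; nra.
Qed.

End TopApproximateEigenvector.

(** * Uniform convergence and characters of the real line *)

Section UniformConvergence.
Context {R : realType}.

(* By Baire's theorem the convergence is uniform on some interval, and
   subadditivity moves that interval to the origin. *)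
Lemma subadditive_cvg0_uniform (F : nat -> R -> R) :
  (forall n t, 0 <= F n t) -> (forall n, continuous (F n)) ->
  (forall n t, F n (- t) = F n t) ->
  (forall n s t, F n (s + t) <= F n s + F n t) ->
  (forall t, F n t @[n --> \oo] --> 0) ->
  forall T e, 0 < e -> \forall n \near \oo, forall t, 0 <= t <= T -> F n t <= e.
Proof.
move=> F0 Fc FN FD Ft T e e0.
have e40 : 0 < e / 4 by lra.
have [k [t0 [d d0 dF]]] : exists k, exists t0, exists2 d, 0 < d &
    forall n t, (k <= n)%N -> `|t - t0| < d -> F n t <= e / 4.
  (* Otherwise the open sets [O k], where some [F n] with [n >= k] exceeds [e / 4], are all dense; a
     point common to them contradicts pointwise convergence. *)
  apply: contrapT => nF.
  pose O k := [set t | exists2 n, (k <= n)%N & e / 4 < F n t].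
  have OD k : open (O k) /\ dense (O k).
    split.
      have -> : O k = \bigcup_(n in [set n | (k <= n)%N]) (F n @^-1` [set x | e / 4 < x]).
        by apply/seteqP; split => [t [n]|t [n]]; exists n.
      apply: bigcup_open => n _; apply: open_comp => [x _|]; first exact: Fc.
      exact: open_gt.
    move=> U [t Ut] oU; apply: contrapT => UO; apply: nF; exists k, t.
    have := open_nbhs_nbhs (conj oU Ut) => /nbhs_ballP[d /= d0 dU].
    exists d => // n s kn sd; rewrite leNgt; apply/negP => es; apply: UO.
    by exists s; split; [apply: dU; rewrite -ball_normE /= distrC|exists n].
  have /(_ setT) := Baire OD; case; first by exists 0.
    exact: openT.
  move=> t [_ Ot]; have /cvgrPdist_lt/(_ _ e40) [k _ kF] := Ft t.
  have [n kn] := Ot k I; have := kF n kn; rewrite sub0r normrN => + es.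
  by rewrite ltNge (le_trans (ltW es))// ler_norm.
have dF2 n s : (k <= n)%N -> `|s| < d -> F n s <= e / 2.
  move=> kn sd; rewrite -[s](addrK t0) (le_trans (FD _ _ _))// FN.
  have := dF n t0 kn; have := dF n (s + t0) kn.
  by rewrite addrK subrr normr0 => /(_ sd) h1 /(_ d0) h2; lra.
have [c c0 cd] : exists2 c, 0 < c & c < d by exists (d / 2); lra.
pose J := Num.bound (T / c).
(* Every point of [[0, T]] is one of these finitely many multiples of [c] plus a remainder below
   [d]; pointwise convergence handles the multiples, [dF2] the remainder. *)
have jF : \forall n \near \oo, forall j, (j < J)%N -> F n (c *+ j) <= e / 2.
  elim: J => [|J IH]; first by near=> n.
  have /cvgrPdist_lt/(_ (e / 2)) FJ := Ft (c *+ J).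
  have {FJ} := FJ ltac:(lra); move: IH; apply: filterS2 => n IH FJ j.
  rewrite ltnS leq_eqVlt => /orP[/eqP ->|/IH//].
  by move: FJ; rewrite sub0r normrN ger0_norm// => /ltW.
near=> n => t /andP[t0' tT].
have j0 : 0 <= t / c by rewrite divr_ge0// ltW.
pose j := Num.truncn (t / c).
have /andP[j1 j2] := truncn_itv j0.
have -> : t = c *+ j + (t - c *+ j) by rewrite addrC subrK.
have jJ : (j < J)%N.
  rewrite -(ltr_nat R) (le_lt_trans j1)//.
  apply: (le_lt_trans (y := T / c)); first by rewrite ler_pM2r ?invr_gt0.
  by apply: archi_boundP; apply: divr_ge0; [exact: le_trans tT|exact: ltW].
rewrite (le_trans (FD _ _ _))//.
have : F n (c *+ j) <= e / 2.
  by move: j jJ {j1 j2}; near: n.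
have : F n (t - c *+ j) <= e / 2.
  apply: dF2; first by near: n; exists k.
  move: j1 j2; rewrite ler_pdivlMr// ltr_pdivrMr// -natr1 -/j mulrDl mul1r mulr_natl => j1 j2.
  rewrite ger0_norm; lra.
lra.
Unshelve. all: by end_near. Qed.

End UniformConvergence.

(** * Continuous characters of the real line *)

Section Characters.
Context {R : realType}.
Implicit Types s t p : R.

Lemma cis_continuous t (e : R) : 0 < e ->
  exists2 d, 0 < d & forall s, `|s - t| < d -> nrm (cis s - cis t) < e.
Proof.
move=> e0; have e20 : 0 < e / 2 by lra.
have /cvgrPdist_lt/(_ _ e20)/nbhs_ballP[d1 /= d10 cosd] := @continuous_cos R t.
have /cvgrPdist_lt/(_ _ e20)/nbhs_ballP[d2 /= d20 sind] := @continuous_sin R t.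
exists (Num.min d1 d2); first by rewrite lt_min d10.
move=> s; rewrite lt_min => /andP[s1 s2].
rewrite (le_lt_trans (nrm_le_ReIm _))//= distrC [X in _ + X]distrC.
have := cosd s; have := sind s; rewrite -!ball_normE /= ![`|t - s|]distrC.
by move=> /(_ s2) + /(_ s1); lra.
Qed.

Lemma cis_dyadic p k : - (pi / 2) < p < pi / 2 -> 0 < cos (p / 2 ^+ k).
Proof.
move=> /andP[p1 p2]; apply: cos_gt0_pihalf.
have k1 : 1 <= (2 : R) ^+ k by rewrite exprn_ege1// ler1n.
have k0 : 0 < (2 : R) ^+ k by rewrite exprn_gt0.
rewrite ltr_pdivlMr// ltr_pdivrMr//; have := pi_gt0 R; set c := 2 ^+ k in k1 *.
by move=> pi0; apply/andP; split; nra.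
Qed.

(* A square root with positive real part is unique, so [z] agrees with [cis] on
   the dyadic multiples of a small enough period. *)
Lemma character_cis (z : R -> R[i]) :
  (forall t, nrm (z t) = 1) -> (forall s t, z (s + t) = z s * z t) ->
  (forall t e, 0 < e ->
    exists2 d, 0 < d & forall s, `|s - t| < d -> nrm (z s - z t) < e) ->
  exists p, forall t, z t = cis (p * t).
Proof.
move=> z1 zD zc.
have zn0 t : z t != 0 by apply/eqP => zt; have := z1 t; rewrite zt nrm0; lra.
have z0 : z 0 = 1 by apply: (mulfI (zn0 0)); rewrite -zD addr0 mulr1.
have zN t : z (- t) = (z t)^-1.
  by apply: (mulfI (zn0 t)); rewrite -zD subrr z0 mulfV.
have zMn t n : z (t *+ n) = z t ^+ n.
  by elim: n => [|n IH]; rewrite ?mulr0n// mulrS zD IH exprS.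
have [d d0 dz] := zc 0 1 ltr01.
have Re_gt0 s : `|s| < d -> 0 < complex.Re (z s).
  move=> sd; have := dz s; rewrite subr0 => /(_ sd) => zs1.
  have := le_lt_trans (Re_le_nrm _) zs1; rewrite z0 /=.
  case: (z s) => x y /=; rewrite ltr_norml; lra.
pose r := d / 2; have r0 : 0 < r by rewrite /r; lra.
have r_lt k : `|r / 2 ^+ k| < d.
  have k1 : 1 <= (2 : R) ^+ k by rewrite exprn_ege1// ler1n.
  rewrite ger0_norm ?divr_ge0 ?exprn_ge0 ?ltW// ltr_pdivrMr ?exprn_gt0//.
  by rewrite /r; nra.
(* A unit complex number with positive real part has the [asin] of its imaginary part as argument.
   Halving this argument stays in the range of positive cosine. *)
have [th [thlt zr]] : exists th, - (pi / 2) < th < pi / 2 /\ z r = cis th.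
  have Re0 : 0 < complex.Re (z r) by apply: Re_gt0; have := r_lt 0; rewrite expr0 divr1.
  have := sqr_nrm (z r); rewrite z1 expr1n; case: (z r) Re0 => x y /= x0 xy.
  have y1 : -1 < y < 1 by rewrite -ltr_norml -(@ltr_pXn2r _ 2)// ?nnegrE// expr1n
    real_normK ?num_real// xy ltrDr exprn_gt0.
  have [/andP[yl yr]] := (y1, y1); have yle : -1 <= y <= 1 by rewrite !ltW.
  exists (asin y); split.
    by rewrite asin_gtNpi2 ?asin_ltpi2 ?yl ?yr ?ltW.
  rewrite /cis cos_asin//; congr (_ +i* _); last by rewrite asinK// in_itv.
  by rewrite xy addrK sqrtr_sqr gtr0_norm.
have z_dyadic k : z (r / 2 ^+ k) = cis (th / 2 ^+ k).
  elim: k => [|k IH]; first by rewrite expr0 !divr1.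
  set w := z _; set v := cis _.
  have ww : w * w = v * v.
    rewrite /w /v -zD -cisD.
    have half x : x / 2 ^+ k.+1 + x / 2 ^+ k.+1 = x / 2 ^+ k :> R.
      by rewrite exprS; field; rewrite expf_neq0.
    by rewrite !half.
  have Rew : 0 < complex.Re w by apply: Re_gt0; exact: r_lt.
  have Rev : 0 < complex.Re v by exact: cis_dyadic.
  have /eqP : (w - v) * (w + v) = 0 by rewrite -subr_sqr !expr2 ww subrr.
  rewrite mulf_eq0 subr_eq0 => /orP[/eqP//|/eqP wv]; exfalso.
  have : complex.Re (w + v) = 0 by rewrite wv.
  by move: Rew Rev; case: (w) => ? ?; case: (v) => ? ? /=; lra.
exists (th / r).
have pos t : 0 <= t -> z t = cis (th / r * t).
  move=> t0; apply/eqP; rewrite -subr_eq0; apply/eqP/nrm_eq0/eqP.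
  rewrite eq_le nrm_ge0 andbT; apply/ler_addgt0Pr => e e0; rewrite add0r.
  have e20 : 0 < e / 2 by lra.
  have [d1 d10 zd] := zc t _ e20.
  have [d2 d20 cd] := cis_continuous (th / r * t) e20.
  pose d3 := Num.min d1 (d2 / (`|th / r| + 1)).
  have d30 : 0 < d3 by rewrite lt_min d10 divr_gt0// ltr_pwDr.
  pose k := Num.bound (r / d3).
  have kr : r / 2 ^+ k < d3.
    rewrite ltr_pdivrMr ?exprn_gt0// mulrC -ltr_pdivrMr//.
    apply: (@lt_trans _ _ k%:R); first by rewrite archi_boundP// divr_ge0// ltW.
    by rewrite -natrX ltr_nat ltn_expl.
  set c := r / 2 ^+ k in kr.
  have c0 : 0 < c by rewrite divr_gt0// exprn_gt0.
  pose m := Num.truncn (t / c).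
  have /andP[m1 m2] := truncn_itv (divr_ge0 t0 (ltW c0)).
  have cmt : `|c *+ m - t| < d3.
    move: m1 m2; rewrite -/m ler_pdivlMr// ltr_pdivrMr// -natr1 mulrDl mul1r mulr_natl.
    rewrite ltr_norml; lra.
  have zE : z (c *+ m) = cis (th / r * (c *+ m)).
    rewrite zMn z_dyadic mulrnAr cisMn; congr (cis _ ^+ _).
    by rewrite /c mulrA divfK// gt_eqF.
  rewrite (le_trans (nrm_dist_triangle (z (c *+ m)) _ _))//.
  have l1 : nrm (z t - z (c *+ m)) < e / 2.
    by rewrite nrm_distC; apply: zd; move: cmt; rewrite lt_min => /andP[].
  have l2 : nrm (z (c *+ m) - cis (th / r * t)) < e / 2.
    rewrite zE; apply: cd; rewrite -mulrBr normrM.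
    move: cmt; rewrite lt_min => /andP[_]; rewrite ltr_pdivlMr ?ltr_pwDr//.
    by apply: le_lt_trans; rewrite mulrC ler_wpM2l// lerDl.
  lra.
move=> t; have [t0|t0] := leP 0 t; first exact: pos.
rewrite -[t in LHS]opprK zN pos; last by rewrite oppr_ge0 ltW.
by rewrite mulrN cisN invrK.
Qed.

End Characters.

(** * Inner flows and approximate eigenoperators *)

Section InnerFlow.
Context {R : realType} {A : cstarAlgType R}.
Variable h : A.
Hypothesis h_sa : star h = h.
Implicit Types (s t q : R) (x y b : A).

Definition exp_it t : A := cstar_exp (('i * t%:C) *: h).

Lemma exp_itD s t : exp_it (s + t) = exp_it s * exp_it t.
Proof.
rewrite /exp_it -cstar_expD; last first.
  by rewrite /GRing.comm -!scalerAl -!scalerAr !scalerA mulrC.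
by rewrite -scalerDl -mulrDr rmorphD.
Qed.

Lemma exp_it0 : exp_it 0 = 1.
Proof. by rewrite /exp_it mulr0 scale0r cstar_exp0. Qed.

Lemma exp_itN t : cstar_exp (- (('i * t%:C) *: h)) = exp_it (- t).
Proof. by rewrite /exp_it rmorphN mulrN scaleNr. Qed.

Lemma star_exp_it t : star (exp_it t) = exp_it (- t).
Proof.
rewrite /exp_it star_cstar_exp starZ h_sa.
have -> : ('i * t%:C)^* = 'i * (- t)%:C; last by [].
by apply/eqP; rewrite eq_complex /=; apply/andP; split; apply/eqP; ring.
Qed.

Lemma exp_itVr t : exp_it t * exp_it (- t) = 1.
Proof. by rewrite -exp_itD subrr exp_it0. Qed.

Lemma exp_itVl t : exp_it (- t) * exp_it t = 1.
Proof. by rewrite -exp_itD addNr exp_it0. Qed.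

Lemma nrm_exp_it_mull t x : nrm (exp_it t * x) = nrm x.
Proof. by rewrite nrm_unitary_mull// star_exp_it exp_itVl. Qed.

Lemma nrm_exp_it_mulr t x : nrm (x * exp_it t) = nrm x.
Proof. by rewrite nrm_unitary_mulr// star_exp_it exp_itVr. Qed.

Definition inner_flow t x : A := exp_it t * x * exp_it (- t).

Lemma inner_flowD s t x : inner_flow (s + t) x = inner_flow s (inner_flow t x).
Proof. by rewrite /inner_flow opprD [- s - t]addrC !exp_itD !mulrA. Qed.

Lemma inner_flow0 x : inner_flow 0 x = x.
Proof. by rewrite /inner_flow oppr0 exp_it0 mul1r mulr1. Qed.

Lemma nrm_inner_flow t x : nrm (inner_flow t x) = nrm x.
Proof. by rewrite /inner_flow nrm_exp_it_mulr nrm_exp_it_mull. Qed.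

Lemma inner_flow_exp_it t x : inner_flow t x * exp_it t = exp_it t * x.
Proof. by rewrite /inner_flow -(mulrA (exp_it t * x)) exp_itVl mulr1. Qed.

Lemma inner_flowB t x y : inner_flow t (x - y) = inner_flow t x - inner_flow t y.
Proof. by rewrite /inner_flow mulrBr mulrBl. Qed.

Lemma inner_flowZ t (a : R[i]) x : inner_flow t (a *: x) = a *: inner_flow t x.
Proof. by rewrite /inner_flow -scalerAr -scalerAl. Qed.

Lemma exp_it_taylor (e : R) : 0 < e -> exists2 d, 0 < d &
  forall t, 0 <= t < d -> nrm (exp_it t - 1 - ('i * t%:C) *: h) <= e * t.
Proof.
move=> e0; pose H := nrm h; have H0 : 0 <= H := nrm_ge0 h.
pose c := H ^+ 2 * expR H + 1.
have c0 : 0 < c by rewrite ltr_pwDr// mulr_ge0 ?exprn_ge0// expR_ge0.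
exists (Num.min 1 (e / c)); first by rewrite lt_min ltr01 divr_gt0.
move=> t /andP[t0]; rewrite lt_min => /andP[t1 te].
rewrite -addrA -opprD nrm_distC (le_trans (nrm_cstar_exp_sub1 _))//.
rewrite nrmZ nrm_scalarM nrm_i mul1r nrm_real ger0_norm// -/H.
have eH : expR (t * H) <= expR H by rewrite ler_expR ler_piMl// ltW.
rewrite exprMn -mulrA (@le_trans _ _ (t ^+ 2 * c))//.
  rewrite ler_wpM2l ?exprn_ge0// (le_trans (ler_wpM2l _ eH)) ?exprn_ge0//.
  by rewrite lerDl.
rewrite expr2 mulrAC ler_wpM2r// mulrC -ler_pdivlMl// mulrC; exact: ltW.
Qed.

End InnerFlow.

Lemma derive0_taylor (R : realType) (f : R -> R) (l e : R) :
  is_derive (0 : R) (1 : R) f l -> 0 < e -> exists2 d, 0 < d &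
  forall t, 0 < t < d -> `|f t - f 0 - l * t| <= e * t.
Proof.
move=> [fd fl] e0.
have /cvgrPdist_lt/(_ _ e0) : h^-1 *: ((f \o shift 0) (h *: 1) - f 0)
    @[h --> (0 : R)^'] --> l by rewrite -fl; exact: fd.
move=> /nbhs_ballP[d /= d0 df]; exists d => // t /andP[t0 td].
have := df t; rewrite -ball_normE /= sub0r normrN gtr0_norm// => /(_ td).
rewrite gt_eqF// => /(_ isT); rewrite addr0 [t *: 1]mulr1 => /ltW lt_e.
have -> : f t - f 0 - l * t = - (t * (l - t^-1 *: (f t - f 0))).
  by rewrite mulrBr [_ *: _]/(_ * _) mulrA mulfV ?gt_eqF// mul1r opprB mulrC.
by rewrite normrN normrM gtr0_norm// mulrC ler_wpM2r// ltW.
Qed.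

Lemma cis_taylor (R : realType) (q e : R) : 0 < q -> 0 < e ->
  exists2 d, 0 < d &
  forall t, 0 < t < d -> nrm (cis (q * t) - 1 - 'i * (q * t)%:C) <= e * t.
Proof.
move=> q0 e0; have e20 : 0 < e / (2 * q) by rewrite divr_gt0// mulr_gt0.
have [d1 d10 c1] := derive0_taylor (is_derive_cos 0) e20.
have [d2 d20 s1] := derive0_taylor (is_derive_sin 0) e20.
exists (Num.min (d1 / q) (d2 / q)); first by rewrite lt_min !divr_gt0.
move=> t /andP[t0]; rewrite lt_min !ltr_pdivlMr// ![t * q]mulrC => /andP[td1 td2].
have qt0 : 0 < q * t by rewrite mulr_gt0.
have := c1 (q * t); have := s1 (q * t); rewrite qt0 td1 td2 => /(_ isT) + /(_ isT).
rewrite cos0 sin0 oppr0 mul0r !subr0 addr0 mul1r => s c.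
rewrite (le_trans (nrm_le_ReIm _))//=.
have -> : cos (q * t) - 1 - (0 * (q * t) - 1 * 0) = cos (q * t) - 1 by ring.
have -> : sin (q * t) - 0 - (0 * 0 + 1 * (q * t)) = sin (q * t) - q * t by ring.
have -> : e * t = e / (2 * q) * (q * t) + e / (2 * q) * (q * t).
  by field; rewrite gt_eqF.
by rewrite lerD.
Qed.

Section ApproximateEigenoperators.
Context {R : realType} {A : cstarAlgType R}.
Implicit Types (h b y z : A) (q : R).

(* [y] averages [t |-> e^{-iqt} e^{ith} b e^{-ith}] over a fine subdivision of
   [0, T], so that the increments telescope. *)
Lemma approximate_eigenoperator h b q (T e d : R) : star h = h ->
  0 < q -> 0 < T -> 0 < d ->
  (forall t, 0 <= t <= T -> nrm (inner_flow h t b - cis (q * t) *: b) <= e) ->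
  exists y, nrm (y - b) <= e /\
    nrm (h * y - y * h - q%:C *: y) <= 2 * nrm b / T + d.
Proof.
move=> hh q0 T0 d0 be.
have e0 : 0 <= e by apply: le_trans (be 0 _); [exact: nrm_ge0|rewrite lexx ltW].
pose Y := nrm b + e; have Y0 : 0 <= Y by rewrite addr_ge0// nrm_ge0.
(* Four first-order errors, each at most [n * k * Y], arise below; divided by the time step [k] they
   add up to at most [d]. *)
pose n := d / (4 * (Y + 1)).
have n0 : 0 < n by rewrite divr_gt0// mulr_gt0// ltr_pwDr.
pose H := nrm h; have H0 : 0 <= H := nrm_ge0 h.
have [d1 d10 uT] := exp_it_taylor h n0.
have [d2 d20 cT] := cis_taylor q0 n0.
(* For a time step below [d3], the second-order term [(c - 1) *: (y * (u - 1))] is also at most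
   [n * k * Y]. The norm of [h] affects only the fineness of the subdivision, never the final
   bound. *)
pose d3 := n / ((q + n) * (H + n)).
have d30 : 0 < d3 by rewrite divr_gt0// mulr_gt0// ltr_wpDl// ltW.
pose d4 := Num.min d1 (Num.min d2 d3).
have d40 : 0 < d4 by rewrite !lt_min d10 d20.
pose K := (Num.bound (T / d4)).+1; pose k := T / K%:R.
have K0 : 0 < K%:R :> R by rewrite ltr0n.
have k0 : 0 < k by rewrite divr_gt0.
have kd : k < d4.
  rewrite ltr_pdivrMr// mulrC -ltr_pdivrMr//.
  rewrite (@lt_trans _ _ (Num.bound (T / d4))%:R)//.
    by rewrite archi_boundP// divr_ge0// ltW.
  by rewrite ltr_nat.
have [kd1 [kd2 kd3]] : k < d1 /\ k < d2 /\ k < d3.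
  by move: kd; rewrite !lt_min => /andP[-> /andP[-> ->]].
pose f j := cis (- (q * (k *+ j))) *: inner_flow h (k *+ j) b.
have fb j : (j <= K)%N -> nrm (f j - b) <= e.
  move=> jK; have : 0 <= k *+ j <= T.
    rewrite mulrn_wge0 ?(ltW k0)//=.
    have -> : k *+ j = T * (K%:R^-1 * j%:R) by rewrite -mulr_natr mulrA.
    rewrite ger_pMr//.
    by rewrite ler_pdivrMl// mulr1 ler_nat.
  move=> /be; rewrite /f cisN; set c := cis _ => le_e.
  have -> : c^-1 *: inner_flow h (k *+ j) b - b =
      c^-1 *: (inner_flow h (k *+ j) b - c *: b).
    by rewrite scalerBr scalerA mulVf ?cis_neq0// scale1r.
  by rewrite nrmZ nrm_scalarV nrm_cis invr1 mul1r.
pose y := K%:R^-1 *: \sum_(j < K) f j.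
have nKV x : nrm ((K%:R : R[i])^-1 *: x) = K%:R^-1 * nrm (x : A).
  by rewrite nrmZ nrm_scalarV nrm_nat.
have yb : nrm (y - b) <= e.
  have -> : y - b = K%:R^-1 *: \sum_(j < K) (f j - b).
    rewrite sumrB scalerBr sumr_const card_ord -[b *+ K]scaler_nat scalerA mulVf ?scale1r//.
    by rewrite pnatr_eq0.
  rewrite nKV ler_pdivrMl// (le_trans (nrm_sum _ _ _))//.
  apply: (@le_trans _ _ (\sum_(j < K) e)).
    by apply: ler_sum => j _; rewrite fb// ltnW.
  by rewrite sumr_const card_ord mulr_natl.
have yY : nrm y <= Y by have := nrm_le_dist b y; rewrite /Y; lra.
exists y; split => //.
pose u := exp_it h k; pose c := cis (q * k).
have shift_y : cis (- (q * k)) *: inner_flow h k y - y = K%:R^-1 *: (f K - f 0%N).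
  rewrite /y inner_flowZ scalerA mulrC -scalerA -scalerBr; congr (_ *: _).
  have fS j : cis (- (q * k)) *: inner_flow h k (f j) = f j.+1.
    rewrite /f inner_flowZ scalerA -inner_flowD mulrSr [k *+ j + k]addrC.
    by rewrite mulrDr opprD cisD.
  have -> : cis (- (q * k)) *: inner_flow h k (\sum_(j < K) f j) =
      \sum_(j < K) f j.+1.
    rewrite /inner_flow mulr_sumr mulr_suml scaler_sumr.
    by apply: eq_bigr => j _; rewrite fS.
  rewrite -sumrB -(big_mkord xpredT (fun j => f j.+1 - f j)).
  by rewrite telescope_sumr.
clearbody y; have uy : nrm (u * y - c *: (y * u)) <= 2 * nrm b / K%:R.
  have -> : u * y - c *: (y * u) =
      c *: (cis (- (q * k)) *: inner_flow h k y - y) * u.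
    rewrite scalerBr scalerA cisN mulfV ?cis_neq0// scale1r mulrBl -scalerAl.
    by rewrite /u inner_flow_exp_it.
  rewrite /u nrm_exp_it_mulr// -/u nrmZ nrm_cis mul1r shift_y nKV mulrC ler_pM2r ?invr_gt0//.
  rewrite (le_trans (nrmB _ _))// /f !nrmZ !nrm_cis !nrm_inner_flow//; lra.
have r_le : nrm (u - 1 - ('i * k%:C) *: h) <= n * k by apply: uT; rewrite ltW.
have p_le : nrm (c - 1 - 'i * (q * k)%:C) <= n * k by apply: cT; rewrite k0.
clearbody u c; set r := u - 1 - _ in r_le; set p := c - 1 - _ in p_le.
have nik : nrm ('i * k%:C : R[i]) = k by rewrite nrm_scalarM nrm_i nrm_real mul1r gtr0_norm.
have u1_le : nrm (u - 1) <= k * (H + n).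
  have := nrm_le_dist (('i * k%:C) *: h) (u - 1).
  by rewrite nrmZ nik -/r -/H; nra.
have c1_le : nrm (c - 1) <= k * (q + n).
  rewrite (le_trans (nrm_le_dist ('i * (q * k)%:C) (c - 1)))// nrm_scalarM nrm_i.
  have qk0 : 0 < q * k by rewrite mulr_gt0.
  rewrite mul1r nrm_real gtr0_norm//; apply: (@le_trans _ _ (q * k + n * k)).
    by rewrite lerD2l.
  by rewrite -mulrDl mulrC.
(* Substituting [u = 1 + i k h + r] and [c = 1 + i k q + p] compares the commutator with
   [u y - c y u], which is small by telescoping; the product [(c - 1) y (u - 1)] cancels the cubic
   term [c y u]. *)
have key : ('i * k%:C) *: (h * y - y * h - q%:C *: y) =
    (u * y - c *: (y * u)) + (c - 1) *: (y * (u - 1)) - (r * y - y * r) + p *: y.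
  have -> : ('i * k%:C) *: (h * y - y * h - q%:C *: y) =
      (('i * k%:C) *: h) * y - y * (('i * k%:C) *: h) - ('i * (q * k)%:C) *: y.
    rewrite !scalerBr scalerAl -scalerAr scalerA; congr (_ - _ - _ *: _).
    by rewrite -mulrA -rmorphM /= [k * q]mulrC.
  have -> : ('i * k%:C) *: h = u - 1 - r by rewrite /r opprB addrC subrK.
  have -> : 'i * (q * k)%:C = c - 1 - p by rewrite /p opprB addrC subrK.
  clearbody r p.
  rewrite !mulrBl !mulrBr !scalerBl !scalerBr !mul1r !mulr1 !scale1r.
  rewrite !opprB !addrA.
  rewrite [LHS](ACl (1*3*4*6*7*8*9*(2*5))%AC) [RHS](ACl (1*8*7*6*9*5*4*(2*3))%AC).
  by rewrite /= !addNr !addr0.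
have : nrm (('i * k%:C) *: (h * y - y * h - q%:C *: y)) <=
    2 * nrm b / K%:R + 4 * (n * k * Y).
  rewrite key.
  have ry : nrm (r * y) <= n * k * Y.
    by rewrite (le_trans (nrmM _ _))// ler_pM ?nrm_ge0.
  have yr : nrm (y * r) <= n * k * Y.
    by rewrite (le_trans (nrmM _ _))// mulrC ler_pM ?nrm_ge0.
  have py : nrm (p *: y) <= n * k * Y by rewrite nrmZ ler_pM ?nrm_ge0.
  have cyu : nrm ((c - 1) *: (y * (u - 1))) <= n * k * Y.
    rewrite nrmZ (@le_trans _ _ (k * (q + n) * (Y * (k * (H + n)))))//.
      rewrite ler_pM ?nrm_ge0// (le_trans (nrmM _ _))// ler_pM ?nrm_ge0//.
    rewrite (_ : _ * _ = k * ((q + n) * (H + n)) * (k * Y)); last by ring.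
    rewrite -[n * k * Y]mulrA ler_wpM2r//; first by rewrite mulr_ge0// ltW.
    by rewrite -ler_pdivlMr ?ltW// mulr_gt0// ltr_wpDl// ltW.
  have := nrmD (u * y - c *: (y * u) + (c - 1) *: (y * (u - 1)) - (r * y - y * r)) (p *: y).
  have := nrmB (u * y - c *: (y * u) + (c - 1) *: (y * (u - 1))) (r * y - y * r).
  have := nrmD (u * y - c *: (y * u)) ((c - 1) *: (y * (u - 1))).
  have := nrmB (r * y) (y * r).
  lra.
rewrite nrmZ nik => le1; rewrite -(ler_pM2l k0) (le_trans le1)//.
have -> : k * (2 * nrm b / T + d) = 2 * nrm b / K%:R + k * d.
  by rewrite /k; field; rewrite !gt_eqF.
rewrite lerD2l (_ : 4 * _ = k * (4 * n * Y)); last by ring.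
rewrite ler_pM2l// /n (_ : _ * _ = d * (Y / (Y + 1))); last first.
  by field; rewrite gt_eqF// ltr_pwDr.
by rewrite ger_pMr// ler_pdivrMr ?ltr_pwDr// mul1r lerDl.
Qed.

(** With [y] an approximate eigenoperator near [b], the vector [y z] nearly has energy [M + q],
    since [(h - M - q) y z = (h y - y h - q y) z + y (h - M) z]. The lower bound above [M] then
    forces it to be small. *)
Lemma nrm_mul_top h b z q (M T e d g : R) : star h = h ->
  0 < q -> 0 < T -> 0 < d ->
  (forall t, 0 <= t <= T -> nrm (inner_flow h t b - cis (q * t) *: b) <= e) ->
  nrm z = 1 -> nrm (h * z - M%:C *: z) <= g ->
  (forall q y, 0 <= q -> q * nrm y <= nrm (h * y - (M + q)%:C *: y)) ->
  nrm (b * z) <= e + q^-1 * (2 * nrm b / T + d + (nrm b + e) * g).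
Proof.
move=> hh q0 T0 d0 be z1 hz hM.
have [y [yb yh]] := approximate_eigenoperator hh q0 T0 d0 be.
have bz : nrm (b * z) <= nrm (y * z) + e.
  rewrite (le_trans (nrm_le_dist (y * z) _))// lerD2l -mulrBl.
  by rewrite (le_trans (nrmM _ _))// z1 mulr1 nrm_distC.
rewrite (le_trans bz)// addrC lerD2l ler_pdivlMl//.
rewrite (le_trans (hM _ _ (ltW q0)))//.
have -> : h * (y * z) - (M + q)%:C *: (y * z) =
    (h * y - y * h - q%:C *: y) * z + y * (h * z - M%:C *: z).
  rewrite !mulrBl mulrBr !mulrA -scalerAl -scalerAr rmorphD /= scalerDl opprD.
  rewrite !addrA [RHS](ACl (1*5*3*(2*4))%AC) /= addNr addr0.
  by rewrite addrAC.
rewrite (le_trans (nrmD _ _))// lerD//.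
  by rewrite (le_trans (nrmM _ _))// z1 mulr1.
rewrite (le_trans (nrmM _ _))// ler_pM ?nrm_ge0//.
by have := nrm_le_dist b y; lra.
Qed.

End ApproximateEigenoperators.

(** * Eigenvectors of isometric representations with compact orbits *)

Section FiniteFourier.
Context {R : realType}.
Implicit Types (L k m n : nat) (a : R[i]).

Definition root_unity L : R[i] := cis (2 * pi / L%:R).

Lemma cis_lt1 (t : R) : 0 < t < 2 * pi -> cis t != 1.
Proof.
move=> /andP[t0 t2]; apply/eqP => -[cost _].
have : 0 < sin (t / 2) by apply: sin_gt0_pi; rewrite divr_gt0//=; lra.
move: cost; rewrite {1}(_ : t = t / 2 + t / 2); last by lra.
rewrite cosD -!expr2; have := cos2Dsin2 (t / 2); nra.
Qed.

Lemma root_unity_exp L k m : (k < L)%N -> (m < L)%N -> k != m ->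
  root_unity L ^+ k != root_unity L ^+ m.
Proof.
move=> kL mL km; wlog mk : k m kL mL km / (m < k)%N => [th|].
  have [mk|mk|mk] := ltngtP m k; first exact: th.
    by rewrite eq_sym; apply: th => //; rewrite eq_sym.
  by rewrite mk eqxx in km.
rewrite -(subnK (ltnW mk)) exprD.
rewrite -[X in _ != X]mul1r; apply/eqP => /(mulIf (expf_neq0 m (cis_neq0 _))).
rewrite -cisMn; apply/eqP/cis_lt1.
have L0 : 0 < L%:R :> R by rewrite ltr0n (leq_ltn_trans _ kL).
have d0 : 0 < (k - m)%:R :> R by rewrite ltr0n subn_gt0.
have dL : (k - m)%:R < L%:R :> R by rewrite ltr_nat (leq_ltn_trans (leq_subr _ _)).
have := pi_gt0 R => pi0; rewrite -[_ *+ (k - m)]mulr_natr.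
rewrite !mulr_gt0 ?invr_gt0//= -mulrA gtr_pMr ?mulr_gt0//.
by rewrite mulrC ltr_pdivrMr// mul1r.
Qed.

Lemma root_unity_pow L : (0 < L)%N -> root_unity L ^+ L = 1.
Proof.
move=> L0; rewrite -cisMn -[_ *+ L]mulr_natr divfK ?pnatr_eq0 ?gtn_eqF//.
by rewrite mulr_natl /cis cos2pi sin2pi.
Qed.

Definition chi L k n : R[i] := root_unity L ^+ (k * n).

Lemma nrm_chi L k n : nrm (chi L k n) = 1.
Proof. by rewrite /chi nrm_scalarX nrm_cis expr1n. Qed.

Lemma chiC L k n : chi L k n = chi L n k.
Proof. by rewrite /chi mulnC. Qed.

Lemma chi_orthogonal L n m : (n < L)%N -> (m < L)%N ->
  \sum_(k < L) chi L k n * (chi L k m)^* = (L * (n == m))%:R.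
Proof.
move=> nL mL; pose z := root_unity L ^+ n / root_unity L ^+ m.
have -> : \sum_(k < L) chi L k n * (chi L k m)^* = \sum_(k < L) z ^+ k.
  apply: eq_bigr => k _; rewrite conjc_nrm1 ?nrm_chi// /chi /z.
  by rewrite expr_div_n ![(k * _)%N]mulnC !exprM.
have [nm|nm] := eqVneq n m.
  rewrite muln1 (eq_bigr (fun=> 1)) ?sumr_const ?card_ord// => k _.
  by rewrite /z nm divff ?expr1n// expf_neq0 ?cis_neq0.
rewrite muln0; have z1 : z - 1 != 0.
  rewrite subr_eq0 /z; apply/eqP => /(congr1 ( *%R^~ (root_unity L ^+ m))).
  rewrite divfK ?expf_neq0 ?cis_neq0// mul1r.
  by apply/eqP/root_unity_exp.
apply: (mulfI z1); rewrite -subrX1 mulr0 /z expr_div_n -!exprM.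
rewrite ![(_ * L)%N]mulnC !exprM !root_unity_pow ?(leq_ltn_trans _ nL)//.
by rewrite !expr1n divr1 subrr.
Qed.

Lemma parseval L (g : 'I_L -> R[i]) :
  \sum_(n < L) nrm (\sum_(k < L) g k * chi L k n) ^+ 2 =
  L%:R * \sum_(k < L) nrm (g k) ^+ 2.
Proof.
apply: complexI; rewrite rmorphM rmorph_nat !rmorph_sum /=.
under eq_bigr do rewrite -mulJ_sqr_nrm rmorph_sum /= mulr_suml.
under [in RHS]eq_bigr do rewrite -mulJ_sqr_nrm.
rewrite exchange_big /= mulr_sumr; apply: eq_bigr => k _.
under eq_bigr do rewrite mulr_sumr.
rewrite exchange_big /= (bigD1 k)//= [X in _ + X]big1 ?addr0 => [|j jk].
  rewrite (eq_bigr (fun n : 'I_L => g k * (g k)^* * (chi L n k * (chi L n k)^* )));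
    last by move=> n _; rewrite rmorphM chiC /=; ring.
  by rewrite -mulr_sumr chi_orthogonal// eqxx muln1 mulrC.
rewrite (eq_bigr (fun n : 'I_L => g k * (g j)^* * (chi L n k * (chi L n j)^* )));
  last by move=> n _; rewrite rmorphM [chi L k n]chiC [chi L j n]chiC /=; ring.
by rewrite -mulr_sumr chi_orthogonal// (inj_eq val_inj) eq_sym (negPf jk) muln0 mulr0.
Qed.

Section Averages.
Variable V : normedModType R[i].
Implicit Types (x : nat -> V).

Definition avg L k x : V := (L%:R)^-1 *: \sum_(n < L) (chi L k n)^* *: x n.

Lemma nrm_avg L k x (X : R) : (0 < L)%N -> (forall n, nrm (x n) <= X) ->
  nrm (avg L k x) <= X.
Proof.
move=> L0 xX; rewrite nrmZ nrm_scalarV nrm_nat ler_pdivrMl ?ltr0n//.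
rewrite (le_trans (nrm_sum _ _ _))// (@le_trans _ _ (\sum_(n < L) X))//.
  by apply: ler_sum => n _; rewrite nrmZ conjc_nrm1 ?nrm_chi// nrm_scalarV nrm_chi
    invr1 mul1r.
by rewrite sumr_const card_ord mulr_natl.
Qed.

(** As [V] carries no inner product, Parseval is applied to the scalar coefficients [D n] of the
    [x n]. The inequality [nrm (D n) <= (e + nrm (D n) ^+ 2 / e) / 2] then plays the part of
    Cauchy-Schwarz. *)
Lemma nrm_sum_avg L (d : 'I_L -> R[i]) x (X e : R) : (0 < L)%N -> 0 < e ->
  (forall n, nrm (x n) <= X) -> \sum_(k < L) nrm (d k) ^+ 2 <= e ^+ 2 ->
  nrm (\sum_(k < L) d k *: avg L k x) <= X * e.
Proof.
move=> L0 e0 xX de; have LR0 : 0 < L%:R :> R by rewrite ltr0n.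
have X0 : 0 <= X by apply: le_trans (xX 0%N); exact: nrm_ge0.
pose D n := \sum_(k < L) d k * (chi L k n)^*.
have -> : \sum_(k < L) d k *: avg L k x = L%:R^-1 *: \sum_(n < L) D n *: x n.
  rewrite /avg; under eq_bigr do rewrite scalerA mulrC -scalerA scaler_sumr.
  rewrite -scaler_sumr exchange_big /=; congr (_ *: _); apply: eq_bigr => n _.
  by rewrite scaler_suml; apply: eq_bigr => k _; rewrite scalerA.
have DE : \sum_(n < L) nrm (D n) ^+ 2 = L%:R * \sum_(k < L) nrm (d k) ^+ 2.
  have nJ (c : R[i]) : nrm c^* = nrm c.
    apply/eqP; rewrite -(@eqrXn2 _ 2)// ?nrm_ge0// !sqr_nrm.
    by case: c => u v /=; rewrite sqrrN.
  under [in RHS]eq_bigr do rewrite -nJ.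
  rewrite -parseval; apply: eq_bigr => n _; rewrite -[in LHS]nJ /D rmorph_sum /=.
  by congr (nrm _ ^+ 2); apply: eq_bigr => k _; rewrite rmorphM /= conjCK.
rewrite nrmZ nrm_scalarV nrm_nat ler_pdivrMl// (le_trans (nrm_sum _ _ _))//.
apply: (@le_trans _ _ (\sum_(n < L) X * ((e + nrm (D n) ^+ 2 / e) / 2))).
  apply: ler_sum => n _; rewrite nrmZ mulrC ler_pM ?nrm_ge0//.
  have := sqr_ge0 (nrm (D n) - e); rewrite ler_pdivlMr// => sq.
  rewrite -(ler_pM2r e0) [leRHS]mulrDl divfK ?gt_eqF//; nra.
rewrite -mulr_sumr mulrCA ler_wpM2l// -mulr_suml ler_pdivrMr//.
rewrite big_split /= sumr_const card_ord -mulr_suml DE -mulr_natl.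
have : L%:R * (\sum_(k < L) nrm (d k) ^+ 2) / e <= L%:R * e.
  by rewrite ler_pdivrMr// -mulrA ler_pM2l// -expr2.
lra.
Qed.

(* With [c_k] the Fourier coefficients of the indicator of [E], the weights
   [c_k ^ 2] are those of the self-convolution, so that
   [\sum_k c_k ^ 2 avg_k = L ^ -2 \sum_(e, e' in E) x_(e + e')]; only boundedly
   many [c_k] are large. *)
Lemma finite_avg_approx L (E : {set 'I_L}) x (x0 : V) (X e d m : R) P :
  (forall n, nrm (x n) <= X) -> 0 < d -> 0 < m -> m * L%:R <= #|E|%:R ->
  (0 < L)%N -> (forall i j : 'I_L, i \in E -> j \in E ->
    (i + j < L)%N /\ nrm (x (i + j)%N - x0) <= e) ->
  1 <= d ^+ 2 * P%:R ->
  exists (a : nat -> R[i]) (k : nat -> nat), (forall j, nrm (a j) <= 1) /\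
    nrm (x0 - \sum_(j < P) a j *: avg L (k j) x) <= e + X * d / m ^+ 2.
Proof.
move=> xX d0 m0 mE L0 Ex dP.
have LR0 : 0 < L%:R :> R by rewrite ltr0n.
have LC0 : (L%:R : R[i]) != 0 by rewrite pnatr_eq0 gtn_eqF.
have X0 : 0 <= X by apply: le_trans (xX 0%N); exact: nrm_ge0.
pose M : R := #|E|%:R / L%:R.
have mM : m <= M by rewrite ler_pdivlMr.
have M0 : 0 < M by exact: lt_le_trans mM.
have MC : (M%:C : R[i]) = #|E|%:R / L%:R by rewrite rmorphM fmorphV /= !rmorph_nat.
have MC0 : (M%:C : R[i]) != 0 by apply/eqP => /complexI /eqP; rewrite gt_eqF.
have E0 : (#|E|%:R : R[i]) != 0 by apply: contra_neq MC0 => E0; rewrite MC E0 mul0r.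
pose c (k : 'I_L) : R[i] := L%:R^-1 * \sum_(i in E) chi L k i.
have cM (k : 'I_L) : nrm (c k) <= M.
  rewrite nrm_scalarM nrm_scalarV nrm_nat mulrC ler_pM2r ?invr_gt0//.
  rewrite (le_trans (nrm_sum _ _ _))// (eq_bigr (fun=> 1)) ?sumr_const// => i _.
  by rewrite nrm_chi.
have c2 : \sum_(k < L) nrm (c k) ^+ 2 <= 1.
  have -> : \sum_(k < L) nrm (c k) ^+ 2 =
      (L%:R ^- 2) * \sum_(k < L) nrm (\sum_(i < L) (i \in E)%:R * chi L i k) ^+ 2.
    rewrite mulr_sumr; apply: eq_bigr => k _.
    rewrite nrm_scalarM exprMn nrm_scalarV nrm_nat -exprVn; congr (_ * nrm _ ^+ 2).
    rewrite big_mkcond /=; apply: eq_bigr => i _; rewrite chiC.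
    by case: ifP; rewrite ?mul1r ?mul0r.
  rewrite parseval -exprVn expr2 -mulrA mulKf ?gt_eqF// ler_pdivrMl// mulr1.
  rewrite -[X in _ <= X]mulr1 mulr_natl -[in X in _ <= X](card_ord L) -sumr_const.
  by apply: ler_sum => i _; case: (i \in E); rewrite ?nrm0 ?nrm_nat ?expr1n// expr0n.
have conv : \sum_(k < L) c k ^+ 2 *: avg L k x =
    (L%:R ^- 2) *: \sum_(i in E) \sum_(j in E) x (i + j)%N.
  transitivity (\sum_(k < L) \sum_(i in E) \sum_(j in E) \sum_(n < L)
      (L%:R ^- 3 * (chi L k (i + j)%N * (chi L k n)^* )) *: x n).
    apply: eq_bigr => k _; rewrite /avg scalerA scaler_sumr.
    under [in RHS]eq_bigr do rewrite exchange_big /=.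
    rewrite exchange_big /=; apply: eq_bigr => n _.
    rewrite scalerA; under [in RHS]eq_bigr do rewrite -scaler_suml.
    rewrite -scaler_suml; congr (_ *: _).
    rewrite /c exprMn [(\sum_(_ in _) _) ^+ 2]expr2 mulr_suml.
    under eq_bigr do rewrite mulr_sumr.
    rewrite !mulr_sumr !mulr_suml; apply: eq_bigr => i _.
    rewrite mulr_sumr !mulr_suml; apply: eq_bigr => j _.
    rewrite /chi mulnDr exprD; field.
    exact: LC0.
  rewrite exchange_big /= scaler_sumr; apply: eq_bigr => i iE.
  rewrite exchange_big /= scaler_sumr; apply: eq_bigr => j jE.
  (* Because [i + j < L], orthogonality selects the index [i + j] itself, without wrapping around
     modulo [L]. *)
  rewrite exchange_big /=; have [ijL _] := Ex _ _ iE jE.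
  under eq_bigr do rewrite -scaler_suml -mulr_sumr chi_orthogonal//.
  rewrite (bigD1 (Ordinal ijL))//= eqxx muln1 big1 ?addr0.
    by congr (_ *: _); field; exact: LC0.
  move=> n; rewrite -val_eqE /= eq_sym => /negPf ->.
  by rewrite muln0 mulr0 scale0r.
(* Division by the squared density of [E] turns the convolution into the mean of [x (i + j)] over
   pairs in [E]. *)
have conv_approx : nrm (x0 - M%:C ^- 2 *: \sum_(k < L) c k ^+ 2 *: avg L k x) <= e.
  rewrite conv scalerA.
  have -> : x0 - (M%:C ^- 2 * L%:R ^- 2) *: \sum_(i in E) \sum_(j in E) x (i + j)%N =
      (#|E|%:R ^- 2) *: \sum_(i in E) \sum_(j in E) (x0 - x (i + j)%N).
    under [in RHS]eq_bigr do rewrite sumrB sumr_const.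
    rewrite sumrB sumr_const scalerBr; congr (_ - _ *: _).
      rewrite -mulrnA -[x0 *+ _]scaler_nat scalerA natrM -expr2 mulVf ?scale1r//.
      by rewrite expf_neq0.
    by rewrite MC; field; rewrite LC0 E0.
  rewrite nrmZ nrm_scalarV nrm_scalarX nrm_nat ler_pdivrMl; last first.
    by rewrite exprn_gt0// ltr0n lt0n; apply: contra_neq E0 => ->.
  rewrite (le_trans (nrm_sum _ _ _))// (@le_trans _ _ (\sum_(i in E) \sum_(j in E) e))//.
    apply: ler_sum => i iE; rewrite (le_trans (nrm_sum _ _ _))//; apply: ler_sum => j jE.
    by rewrite nrm_distC; have [] := Ex _ _ iE jE.
  by rewrite !sumr_const -mulrnA -[e *+ _]mulr_natl natrM expr2.
(* The squares of the [nrm (c k)] sum to at most 1, so at most [P] of them reach [d]. For the others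
   the sum of [nrm (c k ^+ 2) ^+ 2] is at most [d ^+ 2], as [nrm_sum_avg] asks. *)
pose S : {set 'I_L} := [set k : 'I_L | d <= nrm (c k)]%SET.
have small : nrm (\sum_(k in (~: S)%SET) c k ^+ 2 *: avg L k x) <= X * d.
  rewrite big_mkcond (eq_bigr (fun k : 'I_L => (if k \in (~: S)%SET then c k ^+ 2 else 0) *: avg L k x));
    last by move=> k _; case: ifP => //; rewrite scale0r.
  apply: nrm_sum_avg => //; apply: (@le_trans _ _ (\sum_(k < L) d ^+ 2 * nrm (c k) ^+ 2)).
    apply: ler_sum => k _; case: ifPn; rewrite !inE.
      rewrite -ltNge => /ltW kd; rewrite nrm_scalarX [X in X ^+ 2]expr2 exprMn.
      rewrite ler_wpM2r ?exprn_ge0 ?nrm_ge0//.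
      by rewrite ler_pXn2r ?nnegrE ?nrm_ge0 ?(ltW d0).
    by rewrite nrm0 expr0n mulr_ge0 ?exprn_ge0 ?nrm_ge0 ?(ltW d0).
  by rewrite -mulr_sumr ler_piMr// exprn_ge0// ltW.
have S_le : (#|S| <= P)%N.
  rewrite -(ler_nat R) -(ler_pM2l (exprn_gt0 2 d0)) (le_trans _ dP)//.
  rewrite (le_trans _ c2)// mulr_natr -sumr_const [leRHS](bigID (mem S))/=.
  rewrite -[leLHS]addr0 lerD//.
    apply: ler_sum => k; rewrite inE => dk; rewrite ler_sqr ?nnegrE// ?nrm_ge0//.
    exact: ltW.
  by apply: sumr_ge0 => k _; rewrite exprn_ge0// nrm_ge0.
pose k0 := Ordinal L0.
pose s := enum S; have sz : size s = #|S| by rewrite cardE.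
(* Padding with 0 makes the number of terms [P], whatever [L] and [E] are. *)
exists (fun j => if (j < #|S|)%N then c (nth k0 s j) ^+ 2 / M%:C ^+ 2 else 0).
exists (fun j => nth k0 s j); split => [j|].
  case: ifP => _; last by rewrite nrm0.
  rewrite nrm_scalarM nrm_scalarV !nrm_scalarX nrm_real (gtr0_norm M0).
  rewrite ler_pdivrMr ?exprn_gt0// mul1r ler_sqr ?nnegrE// ?nrm_ge0// ltW//.
have -> : \sum_(j < P) (if (j < #|S|)%N then c (nth k0 s j) ^+ 2 / M%:C ^+ 2 else 0) *:
      avg L (nth k0 s j) x =
    M%:C ^- 2 *: \sum_(k in S) c k ^+ 2 *: avg L k x.
  rewrite -[X in _ = _ *: X]big_enum (big_nth k0) big_mkord -/s sz scaler_sumr.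
  rewrite (big_ord_widen_cond _ xpredT (fun j => M%:C ^- 2 *: (c (nth k0 s j) ^+ 2 *:
    avg L (nth k0 s j) x)) S_le) /= [RHS]big_mkcond /=.
  apply: eq_bigr => j _; case: ifP => _; last by rewrite scale0r.
  by rewrite [RHS]scalerA [X in X *: _ = _]mulrC.
have -> : x0 - M%:C ^- 2 *: \sum_(k in S) c k ^+ 2 *: avg L k x =
    x0 - M%:C ^- 2 *: \sum_(k < L) c k ^+ 2 *: avg L k x +
    M%:C ^- 2 *: \sum_(k in (~: S)%SET) c k ^+ 2 *: avg L k x.
  rewrite [in RHS](bigID (mem S))/= scalerDr opprD addrA -[RHS]addrA.
  rewrite [\sum_(k in (~: S)%SET) _](eq_bigl (fun k : 'I_L => k \notin S)).
    by rewrite addNr addr0.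
  by move=> k; rewrite inE.
rewrite (le_trans (nrmD _ _))// lerD// nrmZ nrm_scalarV nrm_scalarX nrm_real gtr0_norm//.
rewrite mulrC ler_pM ?nrm_ge0 ?invr_ge0 ?exprn_ge0 ?(ltW M0)//.
by rewrite lef_pV2 ?posrE ?exprn_gt0// ler_sqr ?nnegrE ?(ltW m0) ?(ltW M0).
Qed.

End Averages.

End FiniteFourier.

(** * Limits of bounded sequences along an ultrafilter *)

Section Ultralimits.
Context {R : realType} {U : set_system nat}.
Hypothesis U_ultra : UltraFilter U.

Lemma ultralimit_real (u : nat -> R) (C : R) : (forall n, `|u n| <= C) ->
  exists l, forall e, 0 < e -> \forall n \near U, `|l - u n| < e.
Proof.
move=> uC; have [l [_ cl]] : `[- C, C]%classic `&` cluster (u @ U) !=set0.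
  apply: (@segment_compact R (- C) C).
  rewrite /= nbhs_simpl /=; apply: filterE => n.
  by rewrite /= in_itv /= -ler_norml.
exists l => e e0; have [//|nU] := in_ultra_setVsetC [set n | `|l - u n| < e] U_ultra.
have Ue : U [set n | e <= `|l - u n|].
  by apply: filterS nU => n nlt; rewrite /= leNgt; apply/negP.
have [||x [/= lx]] := cl [set x | e <= `|l - x|] (ball l e).
- exact: Ue.
- by apply: nbhsx_ballx.
- by rewrite -ball_normE /= ltNge lx.
Qed.

Lemma ultralimit_complex (u : nat -> R[i]) (C : R) : (forall n, nrm (u n) <= C) ->
  exists l, forall e : R, 0 < e -> \forall n \near U, nrm (l - u n) < e.
Proof.
move=> uC.
have [a aP] := ultralimit_real (fun n => le_trans (Re_le_nrm (u n)) (uC n)).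
have [b bP] := ultralimit_real (fun n => le_trans (Im_le_nrm (u n)) (uC n)).
exists (a +i* b) => e e0; have e20 : 0 < e / 2 by lra.
near=> n; rewrite (le_lt_trans (nrm_le_ReIm _))//.
have -> : complex.Re (a +i* b - u n) = a - complex.Re (u n) by case: (u n).
have -> : complex.Im (a +i* b - u n) = b - complex.Im (u n) by case: (u n).
have : `|a - complex.Re (u n)| < e / 2 by near: n; exact: aP.
have : `|b - complex.Im (u n)| < e / 2 by near: n; exact: bP.
lra.
Unshelve. all: by end_near. Qed.

End Ultralimits.

Lemma pigeonhole_class N J (f : 'I_N -> 'I_J) : (0 < J)%N ->
  exists j, (N <= J * #|[set n | f n == j]%SET|)%N.
Proof.
move=> J0; apply: contrapT => /forallNP nj.
have : (\sum_(j < J) J * #|[set n | f n == j]%SET| < \sum_(j < J) N)%N.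
  apply: (@leq_trans (\sum_(j < J) (J * #|[set n | f n == j]%SET|).+1)%N).
    under [X in (_ < X)%N]eq_bigr do rewrite -addn1.
    by rewrite big_split /= sum_nat_const card_ord muln1 -addn1 leq_add2l.
  by apply: leq_sum => j _; rewrite ltnNge; apply/negP/nj.
rewrite sum_nat_const card_ord -big_distrr /= ltnNge leq_mul2l.
suff -> : \sum_(j < J) #|[set n | f n == j]%SET| = N by rewrite leqnn orbT.
rewrite -[RHS](card_ord N) -sum1_card (partition_big f xpredT)//=.
by apply: eq_bigr => j _; rewrite sum1dep_card.
Qed.

Lemma natSinv_lt (R : realType) (d : R) : 0 < d ->
  \forall n \near \oo, n.+1%:R^-1 < d.
Proof.
move=> d0; exists (Num.bound d^-1) => // n /= dn.
rewrite -[d]invrK ltf_pV2 ?posrE ?invr_gt0// (@lt_trans _ _ (Num.bound d^-1)%:R)//.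
  by rewrite archi_boundP// invr_ge0 ltW.
by rewrite ltr_nat.
Qed.

(** * One-parameter groups of isometries with totally bounded orbits *)

Section CompactOrbits.
Context {R : realType}.
Variables (V : completeNormedModType R[i]) (alpha : R -> V -> V).
Hypothesis alpha_linear : forall t (a : R[i]) x y,
  alpha t (a *: x + y) = a *: alpha t x + alpha t y.
Hypothesis nrm_alpha : forall t x, nrm (alpha t x) = nrm x.
Hypothesis alpha0 : forall x, alpha 0 x = x.
Hypothesis alphaD : forall s t x, alpha (s + t) x = alpha s (alpha t x).
Hypothesis alpha_continuous : forall x t (e : R), 0 < e ->
  exists2 d, 0 < d & forall s, `|s - t| < d -> nrm (alpha s x - alpha t x) < e.
Hypothesis orbit_totally_bounded : forall x (e : R), 0 < e ->
  exists J (c : 'I_J -> V), forall t, exists j, nrm (alpha t x - c j) < e.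
Implicit Types (x y : V) (t : R).

Let alpha_add t x y : alpha t (x + y) = alpha t x + alpha t y.
Proof. by rewrite -[x in LHS]scale1r alpha_linear scale1r. Qed.

Let alpha_zero t : alpha t 0 = 0.
Proof. by apply: nrm_eq0; rewrite nrm_alpha nrm0. Qed.

Let alpha_scale t (a : R[i]) x : alpha t (a *: x) = a *: alpha t x.
Proof. by rewrite -[a *: x]addr0 alpha_linear alpha_zero addr0. Qed.

Let alpha_sub t x y : alpha t (x - y) = alpha t x - alpha t y.
Proof. by rewrite -scaleN1r addrC alpha_linear scaleN1r addrC. Qed.

Let alpha_sum t n (F : 'I_n -> V) :
  alpha t (\sum_(i < n) F i) = \sum_(i < n) alpha t (F i).
Proof. by rewrite (big_morph _ (alpha_add t) (alpha_zero t)). Qed.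

Let orbit_coloring x (e : R) : 0 < e -> exists J (c : 'I_J -> V) (col : R -> 'I_J),
  forall t, nrm (alpha t x - c (col t)) < e.
Proof.
move=> e0; have [J [c cP]] := orbit_totally_bounded x e0.
by have [col colP] := choice cP; exists J, c, col.
Qed.

(* Times at which the orbit visits one and the same small ball differ by almost
   periods of [x]; their density is at least [1 / (2 J)] by the pigeonhole
   principle, uniformly in [N] and in the step [t]. *)
Lemma orbit_avg_approx x (e : R) : 0 < e -> exists P, forall N t, (0 < N)%N ->
  exists (a : nat -> R[i]) (k : nat -> nat), (forall j, nrm (a j) <= 1) /\
  nrm (x - \sum_(j < P) a j *: avg (2 * N) (k j) (fun n => alpha (t *+ n) x)) <= e.
Proof.
move=> e0; have e80 : 0 < e / 8 by lra.
have [J [c [col colP]]] := orbit_coloring x e80.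
have J0 : (0 < J)%N by apply: leq_ltn_trans (ltn_ord (col 0)).
have JR0 : 0 < J%:R :> R by rewrite ltr0n.
pose X := nrm x; have X0 : 0 <= X := nrm_ge0 x.
(* With [m = 1 / (2 J)] this makes [X * d / m ^+ 2] at most [e / 2]. The radius [e / 8] gives almost
   periods up to [e / 4], and sums of two of them up to [e / 2]. *)
pose d := e / (8 * J%:R ^+ 2 * (X + 1)).
have d0 : 0 < d by rewrite divr_gt0// !mulr_gt0// ?exprn_gt0// ltr_pwDr.
pose m : R := (2 * J%:R)^-1; have m0 : 0 < m by rewrite invr_gt0 mulr_gt0.
exists (Num.bound (d ^- 2)) => N t N0.
have [j] := pigeonhole_class (fun n : 'I_N => col (t *+ n)) J0.
set F := [set n : 'I_N | _]%SET => NF.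
have /card_gt0P[i0 i0F] : (0 < #|F|)%N.
  by rewrite lt0n; apply: contraTneq NF => ->; rewrite muln0 -ltnNge.
(* Subtracting the earliest visit keeps the differences natural numbers below [N], so that sums of
   two stay below [2 * N]. *)
have [n0 n0F n0min] := arg_minnP (fun n : 'I_N => n : nat) i0F.
have hlt (n : 'I_N) : (n - n0 < 2 * N)%N.
  by rewrite (leq_ltn_trans (leq_subr _ _))// (leq_trans (ltn_ord n))// leq_pmull.
pose h n := Ordinal (hlt n); have {}n0F : n0 \in F by exact: n0F.
have hinj : {in F &, injective h}.
  move=> n n' /n0min nn /n0min nn' /(congr1 val)/= hn; apply: val_inj => /=.
  by rewrite -(subnK nn) hn subnK.
have near_x (n : 'I_N) : n \in F -> nrm (alpha (t *+ (n - n0)) x - x) <= e / 4.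
  move=> nF; have le_n := n0min n nF.
  rewrite -(nrm_alpha (t *+ n0)) alpha_sub -alphaD -mulrnDr subnKC//.
  move: nF n0F; rewrite !inE => /eqP nj /eqP n0j.
  have := colP (t *+ n); have := colP (t *+ n0); rewrite nj n0j.
  have := nrm_dist_triangle (c j) (alpha (t *+ n) x) (alpha (t *+ n0) x).
  by rewrite [nrm (c j - _)]nrm_distC; lra.
have [|||||a [k [ak xk]]] := @finite_avg_approx R V (2 * N) (h @: F)%SET
  (fun n => alpha (t *+ n) x) x X (e / 2) d m (Num.bound (d ^- 2)) _ d0 m0.
- by move=> n; rewrite nrm_alpha.
- rewrite card_in_imset// /m -ler_pdivlMl ?invr_gt0 ?mulr_gt0// invrK natrM -mulrA.
  by rewrite ler_pM2l// -natrM ler_nat.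
- by rewrite muln_gt0.
- move=> _ _ /imsetP[n nF ->] /imsetP[n' n'F ->] /=; split.
    by rewrite mul2n -addnn -addSn leq_add// ?(leq_ltn_trans (leq_subr _ _))// ltnW//
      (leq_ltn_trans (leq_subr _ _)).
  rewrite mulrnDr alphaD.
  rewrite (le_trans (nrm_dist_triangle (alpha (t *+ (n - n0)) x) _ _))//.
  rewrite -alpha_sub nrm_alpha; have := near_x _ nF; have := near_x _ n'F; lra.
- rewrite -ler_pdivrMl ?exprn_gt0// mulr1 ltW// archi_boundP// invr_ge0.
  by rewrite exprn_ge0// ltW.
exists a, k; split => //; rewrite (le_trans xk)//.
have -> : X * d / m ^+ 2 = e / 2 * (X / (X + 1)).
  rewrite /d /m; field; rewrite !gt_eqF ?ltr_pwDr//.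
have : X / (X + 1) <= 1 by rewrite ler_pdivrMr ?ltr_pwDr// mul1r lerDl.
nra.
Qed.

Lemma avg_sub L k (x y : nat -> V) :
  avg L k x - avg L k y = avg L k (fun n => x n - y n).
Proof.
rewrite /avg -scalerBr -sumrB; congr (_ *: _); apply: eq_bigr => n _.
by rewrite -scalerBr.
Qed.

(** After multiplication by the character the shifted sum telescopes; only its two end terms, of
    norm [nrm x] each, remain. *)
Lemma nrm_avg_shift L k x t : (0 < L)%N ->
  nrm (alpha t (avg L k (fun n => alpha (t *+ n) x)) -
       root_unity L ^+ k *: avg L k (fun n => alpha (t *+ n) x)) <=
  2 * nrm x / L%:R.
Proof.
move=> L0; set w := root_unity L ^+ k; have w1 : nrm w = 1.
  by rewrite nrm_scalarX nrm_cis expr1n.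
have w0 : w != 0 by rewrite expf_neq0// cis_neq0.
have chiS n : w * (chi L k n.+1)^* = (chi L k n)^*.
  rewrite !conjc_nrm1 ?nrm_chi// /chi mulnS exprD invfM mulrA mulfV ?mul1r//.
pose f n := (chi L k n)^* *: alpha (t *+ n) x.
have -> : alpha t (avg L k (fun n => alpha (t *+ n) x)) -
    w *: avg L k (fun n => alpha (t *+ n) x) = L%:R^-1 *: (w *: (f L - f 0%N)).
  rewrite /avg alpha_scale alpha_sum scalerA [w * _]mulrC -scalerA -scalerBr.
  congr (_ *: _); rewrite -(telescope_sumr f (leq0n L)) big_mkord.
  rewrite !scaler_sumr -sumrB; apply: eq_bigr => n _.
  by rewrite alpha_scale -alphaD -mulrS scalerBr /f [in RHS]scalerA chiS.
rewrite nrmZ nrm_scalarV nrm_nat mulrC ler_pM2r ?invr_gt0 ?ltr0n//.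
rewrite nrmZ w1 mul1r (le_trans (nrmB _ _))// /f !nrmZ !conjc_nrm1 ?nrm_chi//.
by rewrite !nrm_scalarV !nrm_chi !nrm_alpha; lra.
Qed.

Lemma nrm_avg_shiftMn L k x t j : (0 < L)%N ->
  nrm (alpha (t *+ j) (avg L k (fun n => alpha (t *+ n) x)) -
       root_unity L ^+ (k * j) *: avg L k (fun n => alpha (t *+ n) x)) <=
  2 * nrm x / L%:R *+ j.
Proof.
move=> L0; set y := avg L k _; elim: j => [|j IH].
  by rewrite muln0 mulr0n alpha0 expr0 scale1r subrr nrm0.
rewrite mulrS alphaD mulnS exprD mulrS.
rewrite (le_trans (nrm_dist_triangle (alpha t (root_unity L ^+ (k * j) *: y)) _ _))//.
rewrite -alpha_sub nrm_alpha addrC lerD// alpha_scale mulrC -scalerA -scalerBr nrmZ.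
by rewrite nrm_scalarX nrm_cis expr1n mul1r nrm_avg_shift.
Qed.

Section AlongUltrafilter.
Variable U : set_system nat.
Hypothesis U_ultra : UltraFilter U.
Hypothesis U_oo : \oo `<=` U.

(* Up to [e], an average of the orbit is a combination with bounded coefficients
   of finitely many fixed vectors. *)
Lemma avg_ultralimit x (L k : nat -> nat) (t : nat -> R) : (forall n, (0 < L n)%N) ->
  exists y, forall e : R, 0 < e -> \forall n \near U,
    nrm (y - avg (L n) (k n) (fun i => alpha (t n *+ i) x)) < e.
Proof.
move=> L0; apply: cauchy_nrm_cvg => e e0.
have e20 : 0 < e / 2 by lra.
have [J [c [col colP]]] := orbit_coloring x e20.
pose W n j : R[i] := (L n)%:R^-1 *
  \sum_(i < L n | col (t n *+ i) == j) (chi (L n) (k n) i)^*.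
have W1 n j : nrm (W n j) <= 1.
  rewrite nrm_scalarM nrm_scalarV nrm_nat ler_pdivrMl ?ltr0n// mulr1.
  rewrite (le_trans (nrm_sum _ _ _))// big_mkcond/=.
  rewrite (@le_trans _ _ (\sum_(i < L n) 1))//; last by rewrite sumr_const card_ord.
  apply: ler_sum => i _; case: ifP => // _.
  by rewrite conjc_nrm1 ?nrm_chi// nrm_scalarV nrm_chi invr1.
have /choice[l lP] j := ultralimit_complex U_ultra (fun n => W1 n j).
exists (\sum_(j < J) l j *: c j).
pose S := \sum_(j < J) nrm (c j); have S0 : 0 <= S by apply: sumr_ge0 => j _; exact: nrm_ge0.
have d0 : 0 < e / 2 / (S + 1) by rewrite divr_gt0// ltr_pwDr.
have Wl : \forall n \near U, forall j, nrm (l j - W n j) < e / 2 / (S + 1).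
  by apply: filter_forall => j; exact: lP.
apply: filterS Wl => n Wl.
have WE : \sum_(j < J) W n j *: c j = avg (L n) (k n) (fun i => c (col (t n *+ i))).
  rewrite /avg (partition_big (fun i : 'I_(L n) => col (t n *+ i)) xpredT)//=.
  rewrite scaler_sumr; apply: eq_bigr => j _; rewrite /W -scalerA scaler_suml.
  by congr (_ *: _); apply: eq_bigr => i /eqP ->.
rewrite (le_lt_trans (nrm_dist_triangle (\sum_(j < J) W n j *: c j) _ _))//.
have le1 : nrm (\sum_(j < J) l j *: c j - \sum_(j < J) W n j *: c j) < e / 2.
  rewrite -sumrB (le_lt_trans (nrm_sum _ _ _))//.
  apply: (@le_lt_trans _ _ (\sum_(j < J) e / 2 / (S + 1) * nrm (c j))).
    by apply: ler_sum => j _; rewrite -scalerBl nrmZ ler_wpM2r ?nrm_ge0// ltW.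
  rewrite -mulr_sumr -/S mulrAC ltr_pdivrMr ?ltr_pwDr//.
  by rewrite ltr_pM2l// ltrDl.
have le2 : nrm (\sum_(j < J) W n j *: c j -
    avg (L n) (k n) (fun i => alpha (t n *+ i) x)) <= e / 2.
  rewrite WE avg_sub; apply: nrm_avg => // i; rewrite nrm_distC; exact/ltW.
lra.
Qed.

(** The time [s] is reached up to [1 / (n + 1)] in at most [s (n + 1)] grid steps, each costing
    [nrm x / (n + 1) ^ 2] by [nrm_avg_shift]. The total [s * nrm x / (n + 1)] vanishes: the number
    of samples is quadratic in the inverse step for this reason. *)
Lemma ultralimit_eigenvector x y (k : nat -> nat) :
  (forall e : R, 0 < e -> \forall n \near U,
     nrm (y - avg (2 * (n.+1 * n.+1)) (k n) (fun i => alpha (n.+1%:R^-1 *+ i) x)) < e) ->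
  forall s, 0 <= s -> exists2 z : R[i], nrm z = 1 & alpha s y = z *: y.
Proof.
move=> ky s s0.
pose j n := Num.truncn (s * n.+1%:R).
pose Ln n := (2 * (n.+1 * n.+1))%N.
pose w n := root_unity (Ln n) ^+ (k n * j n)%N : R[i].
have w1 n : nrm (w n) = 1 by rewrite nrm_scalarX nrm_cis expr1n.
have w1le n : nrm (w n) <= 1 by rewrite w1.
have [z zP] := ultralimit_complex U_ultra w1le.
exists z.
  apply/eqP; rewrite eq_le; apply/andP; split; apply/ler_addgt0Pr => e e0.
    have [n] := filter_ex (zP _ e0).
    by have := nrm_le_dist (w n) z; rewrite w1; lra.
  have [n] := filter_ex (zP _ e0).
  by have := nrm_le_dist z (w n); rewrite w1 nrm_distC; lra.
apply: nrm_dist_le0 => e e0.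
have e50 : 0 < e / 5 by lra.
have y0 : 0 < e / 5 / (nrm y + 1) by rewrite divr_gt0// ltr_pwDr// nrm_ge0.
have [d d0 dP] := alpha_continuous y s e50.
have sx0 : 0 <= s * nrm x by rewrite mulr_ge0// nrm_ge0.
have c0 : 0 < e / 5 / (s * nrm x + 1) by rewrite divr_gt0// ltr_pwDr.
have small : \forall n \near U, s * nrm x / n.+1%:R < e / 5 /\ n.+1%:R^-1 < d.
  apply: U_oo; apply: filterI; last exact: natSinv_lt.
  apply: filterS (natSinv_lt c0) => n nc.
  apply: le_lt_trans (_ : n.+1%:R^-1 * (s * nrm x + 1) < e / 5).
    by rewrite mulrC ler_wpM2l// lerDl.
  by rewrite -ltr_pdivlMr// ltr_pwDr.
have [n [[/= kn zn] [xn dn]]] := filter_ex (filterI (filterI (ky _ e50) (zP _ y0)) small).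
set v := avg _ _ _ in kn.
have n0 : 0 < n.+1%:R :> R by [].
have /andP[j1 j2] := truncn_itv (mulr_ge0 s0 (ltW n0)).
have sj : nrm (alpha s y - alpha (n.+1%:R^-1 *+ j n) y) < e / 5.
  rewrite nrm_distC; apply: dP; apply: le_lt_trans dn.
  have nj : n.+1%:R * (n.+1%:R^-1 *+ j n) = (j n)%:R :> R.
    by rewrite -[_ *+ j n]mulr_natr mulrA mulfV ?mul1r// gt_eqF.
  rewrite -(ler_pM2l n0) -[X in X * `|_|](gtr0_norm n0) -normrM mulrBr nj.
  rewrite mulfV ?gt_eqF// ler_norml; move: j1 j2.
  rewrite -/(j n) -[(j n).+1%:R]natr1 [s * _]mulrC; lra.
have l2 : nrm (alpha (n.+1%:R^-1 *+ j n) y - alpha (n.+1%:R^-1 *+ j n) v) < e / 5.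
  by rewrite -alpha_sub nrm_alpha.
have l3 : nrm (alpha (n.+1%:R^-1 *+ j n) v - w n *: v) < e / 5.
  rewrite (le_lt_trans (nrm_avg_shiftMn _ _ _ _ _))// (le_lt_trans _ xn)//.
  rewrite -[_ *+ j n]mulr_natr natrM natrM.
  have -> : 2 * nrm x / (2 * (n.+1%:R * n.+1%:R)) * (j n)%:R =
      nrm x / n.+1%:R * ((j n)%:R / n.+1%:R) by field; rewrite gt_eqF.
  rewrite -[leRHS]mulrA [leLHS]mulrC ler_wpM2r ?divr_ge0 ?nrm_ge0//.
  by rewrite ler_pdivrMr.
have l4 : nrm (w n *: v - w n *: y) < e / 5.
  by rewrite -scalerBr nrmZ w1 mul1r nrm_distC.
have l5 : nrm (w n *: y - z *: y) <= e / 5.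
  rewrite -scalerBl nrmZ nrm_distC.
  rewrite (@le_trans _ _ (e / 5 / (nrm y + 1) * nrm y))//.
    by rewrite ler_wpM2r ?nrm_ge0// ltW.
  rewrite mulrAC ler_pdivrMr ?ltr_pwDr ?nrm_ge0// ler_pM2l// lerDl//.
have := nrm_dist_triangle (alpha (n.+1%:R^-1 *+ j n) y) (alpha s y) (z *: y).
have := nrm_dist_triangle (alpha (n.+1%:R^-1 *+ j n) v) (alpha (n.+1%:R^-1 *+ j n) y) (z *: y).
have := nrm_dist_triangle (w n *: v) (alpha (n.+1%:R^-1 *+ j n) v) (z *: y).
have := nrm_dist_triangle (w n *: y) (w n *: v) (z *: y).
lra.
Qed.

End AlongUltrafilter.

(** The eigenvalue of a nonzero [y] is unique at each time, hence multiplicative and continuous in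
    time. Negative times are reached by inversion. *)
Lemma eigenvector_cis y :
  (forall s, 0 <= s -> exists2 z : R[i], nrm z = 1 & alpha s y = z *: y) ->
  exists p, forall t, alpha t y = cis (p * t) *: y.
Proof.
move=> eig; have [->|y0] := eqVneq y 0.
  by exists 0 => t; rewrite alpha_zero scaler0.
have ny : 0 < nrm y.
  by rewrite lt_neqAle nrm_ge0 andbT eq_sym; apply: contra_neq y0 => /nrm_eq0.
have {eig} eig s : exists z : R[i], nrm z = 1 /\ alpha s y = z *: y.
  have [s0|s0] := leP 0 s; first by have [z] := eig s s0; exists z.
  have [|z z1 zy] := eig (- s); first by rewrite oppr_ge0 ltW.
  have z0 : z != 0 by apply/eqP => z0; move: z1; rewrite z0 nrm0; lra.
  exists z^-1; rewrite nrm_scalarV z1 invr1; split => //.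
  have : alpha s (alpha (- s) y) = y by rewrite -alphaD subrr alpha0.
  rewrite zy alpha_scale => {2}<-.
  by rewrite scalerA mulVf// scale1r.
have [z zP] := choice eig.
have zI (a b : R[i]) : a *: y = b *: y -> a = b.
  move=> ab; apply/eqP; rewrite -subr_eq0; apply: contra_neqT y0 => ab0.
  have : (a - b) *: y == 0 by rewrite scalerBl ab subrr.
  by rewrite scaler_eq0 (negPf ab0) => /eqP.
have [|||p pP] := @character_cis R z.
- by move=> t; have [] := zP t.
- move=> s t; apply: zI; have [_ <-] := zP (s + t); have [_ zt] := zP t.
  by rewrite alphaD zt alpha_scale; have [_ ->] := zP s; rewrite scalerA mulrC.
- move=> t e e0; have [d d0 dP] := alpha_continuous y t (mulr_gt0 e0 ny).
  exists d => // s /dP; have [_ ->] := zP s; have [_ ->] := zP t.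
  by rewrite -scalerBl nrmZ ltr_pM2r.
by exists p => t; have [_ ->] := zP t; rewrite pP.
Qed.

(** The bound [P] from [orbit_avg_approx] is independent of the grid, so the [P] averages and their
    coefficients converge along one ultrafilter, and the limit is a sum of [P] eigenvectors. A
    closed invariant subspace [W] contains the averages and their limits. *)
Lemma eigenvectors_dense (W : set V) : closed W -> W 0 ->
  (forall x y, W x -> W y -> W (x + y)) ->
  (forall (a : R[i]) x, W x -> W (a *: x)) ->
  (forall t x, W x -> W (alpha t x)) ->
  forall x (e : R), W x -> 0 < e -> exists P (y : nat -> V) (p : nat -> R),
    (forall j, W (y j) /\ forall t, alpha t (y j) = cis (p j * t) *: y j) /\
    nrm (x - \sum_(j < P) y j) < e.
Proof.
move=> cW W0 WD WZ Walpha x e Wx e0.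
have e20 : 0 < e / 2 by lra.
have [P xP] := orbit_avg_approx x e20.
have [U [U_ultra U_oo]] := @ultraFilterLemma nat \oo _.
pose N n := (n.+1 * n.+1)%N.
have /choice[a aP] n := xP (N n) n.+1%:R^-1 isT.
have /choice[k kP] := aP.
pose v n j := avg (2 * N n) (k n j) (fun i => alpha (n.+1%:R^-1 *+ i) x).
have /choice[y yP] j := @avg_ultralimit U U_ultra x (fun n => 2 * N n)%N (k ^~ j)
  (fun n => n.+1%:R^-1) (fun n => isT).
have /choice[b bP] j := ultralimit_complex U_ultra (fun n => (kP n).1 j).
have Wv n j : W (v n j).
  apply: (WZ); apply: (big_ind W) => // i _; apply: (WZ); exact: Walpha.
have Wy j : W (y j).
  apply: (nrm_closed cW) => d d0; have [n vn] := filter_ex (yP j _ d0).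
  by exists (v n j).
have /choice[p pP] j : exists p, forall t, alpha t (y j) = cis (p * t) *: y j.
  apply: eigenvector_cis; exact: (ultralimit_eigenvector U_ultra U_oo (yP j)).
exists P, (fun j => b j *: y j), p; split => [j|].
  split; first exact/WZ/Wy.
  by move=> t; rewrite alpha_scale pP !scalerA mulrC.
pose X := nrm x; have X0 : 0 <= X := nrm_ge0 x.
have vX n j : nrm (v n j) <= X.
  by apply: nrm_avg => // i; rewrite nrm_alpha.
have b1 j : nrm (b j) <= 1.
  apply/ler_addgt0Pr => d d0; have [n bn] := filter_ex (bP j _ d0).
  by have := nrm_le_dist (a n j) (b j); have := (kP n).1 j; lra.
pose d := e / (4 * (P%:R + 1) * (X + 1)).
have d0 : 0 < d by rewrite divr_gt0// !mulr_gt0// ltr_wpDl.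
have near_all : \forall n \near U, forall j : 'I_P,
    nrm (b j - a n j) < d /\ nrm (y j - v n j) < d.
  by apply: filter_forall => j; apply: filterI; [exact: bP|exact: yP].
have [n nd] := filter_ex near_all.
rewrite (le_lt_trans (nrm_dist_triangle (\sum_(j < P) a n j *: v n j) _ _))//.
apply: (@le_lt_trans _ _ (e / 2 + e / 4)); last by lra.
rewrite lerD//; first exact: (kP n).2.
rewrite -sumrB (le_trans (nrm_sum _ _ _))//.
apply: (@le_trans _ _ (\sum_(j < P) d * (X + 1))).
  apply: ler_sum => j _; have [bj yj] := nd j.
  have -> : a n j *: v n j - b j *: y j =
      (a n j - b j) *: v n j + b j *: (v n j - y j).
    by rewrite scalerBl scalerBr addrA subrK.
  rewrite (le_trans (nrmD _ _))// mulrDr mulr1 lerD// nrmZ nrm_distC.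
    by rewrite ler_pM ?nrm_ge0// ltW.
  rewrite -[leRHS]mul1r ler_pM ?nrm_ge0// ltW//.
rewrite sumr_const card_ord -[_ *+ P]mulr_natl /d.
have -> : P%:R * (e / (4 * (P%:R + 1) * (X + 1)) * (X + 1)) =
    e / 4 * (P%:R / (P%:R + 1)).
  by field; rewrite !gt_eqF// ltr_wpDl.
have P0 : 0 < P%:R + 1 :> R by rewrite ltr_wpDl.
have : P%:R / (P%:R + 1) <= 1 :> R by rewrite ler_pdivrMr// mul1r lerDl.
nra.
Qed.

End CompactOrbits.

(** * Approximately inner compact flows *)

Lemma subadditive_even_continuous (R : realType) (F : R -> R) :
  (forall t, 0 <= F t) -> (forall t, F (- t) = F t) ->
  (forall s t, F (s + t) <= F s + F t) ->
  (forall e, 0 < e -> exists2 d, 0 < d & forall t, 0 <= t < d -> F t < e) ->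
  continuous F.
Proof.
move=> F0 FN FD Fe t; apply/cvgrPdist_lt => e e0.
have [d d0 dF] := Fe _ e0; apply/nbhs_ballP; exists d => // s.
rewrite /ball_ /= => ts.
have Fst : F (s - t) < e.
  have [st|st] := leP 0 (s - t).
    by apply: dF; rewrite st -(ger0_norm st) distrC.
  rewrite -FN; apply: dF; rewrite opprB.
  have ts0 : 0 <= t - s by lra.
  by rewrite ts0 -(ger0_norm ts0).
have h1 : F s <= F t + F (s - t) by have := FD t (s - t); rewrite addrC subrK.
have h2 : F t <= F s + F (s - t) by have := FD s (t - s); rewrite -(FN (t - s)) opprB addrC subrK.
by rewrite ltr_norml; lra.
Qed.

Section InnerLimits.
Context {R : realType} {A : cstarAlgType R}.
Implicit Types (h b x : A) (q t : R).

Lemma exp_it_continuous0 h (e : R) : 0 < e ->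
  exists2 d, 0 < d & forall t, 0 <= t < d -> nrm (exp_it h t - 1) < e.
Proof.
move=> e0; have [d d0 dP] := exp_it_taylor h ltr01.
have H0 : 0 < nrm h + 1 by rewrite ltr_wpDl// nrm_ge0.
exists (Num.min d (e / (nrm h + 1))); first by rewrite lt_min d0 divr_gt0.
move=> t /andP[t0]; rewrite lt_min ltr_pdivlMr// => /andP[td te].
have := dP t; rewrite t0 td mul1r => /(_ isT) le_t.
rewrite (le_lt_trans (nrm_le_dist (('i * t%:C) *: h) _))//.
rewrite nrmZ nrm_scalarM nrm_i mul1r nrm_real ger0_norm//.
apply: le_lt_trans te; rewrite mulrDr mulr1 lerD2l//.
Qed.

(** The inner flow and multiplication by [cis (q * t)] are commuting isometric groups, which makes
    the defect even and subadditive in [t], as the Baire argument requires. *)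
Definition flow_defect h q b t := nrm (inner_flow h t b - cis (q * t) *: b).

Lemma flow_defectD h q b s t : star h = h ->
  flow_defect h q b (s + t) <= flow_defect h q b s + flow_defect h q b t.
Proof.
move=> hh; rewrite /flow_defect inner_flowD mulrDr cisD.
have -> : inner_flow h s (inner_flow h t b) - (cis (q * s) * cis (q * t)) *: b =
    inner_flow h s (inner_flow h t b - cis (q * t) *: b) +
    cis (q * t) *: (inner_flow h s b - cis (q * s) *: b).
  by rewrite inner_flowB inner_flowZ scalerBr scalerA [cis (q * t) * _]mulrC addrA subrK.
by rewrite (le_trans (nrmD _ _))// nrm_inner_flow// nrmZ nrm_cis mul1r addrC.
Qed.

Lemma flow_defectN h q b t : star h = h ->
  flow_defect h q b (- t) = flow_defect h q b t.
Proof.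
move=> hh; rewrite /flow_defect.
have -> : inner_flow h (- t) b - cis (q * - t) *: b =
    - (cis (q * - t) *: inner_flow h (- t) (inner_flow h t b - cis (q * t) *: b)).
  rewrite inner_flowB -inner_flowD addNr inner_flow0 inner_flowZ scalerBr scalerA.
  by rewrite -cisD -mulrDr addNr mulr0 cis0 scale1r opprB.
by rewrite nrmN nrmZ nrm_cis mul1r nrm_inner_flow.
Qed.

Lemma flow_defect_continuous h q b : star h = h -> continuous (flow_defect h q b).
Proof.
move=> hh; apply: subadditive_even_continuous.
- by move=> t; exact: nrm_ge0.
- by move=> t; exact: flow_defectN.
- by move=> s t; exact: flow_defectD.
move=> e e0; pose B := nrm b + 1.
have B0 : 0 < B by rewrite ltr_wpDl// nrm_ge0.
have e4 : 0 < e / (4 * B) by rewrite divr_gt0// mulr_gt0.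
have [d1 d10 uP] := exp_it_continuous0 h e4.
have [d2 d20 cP] := cis_continuous (0 : R) e4.
pose d3 := d2 / (`|q| + 1); have q1 : 0 < `|q| + 1 by rewrite ltr_wpDl.
exists (Num.min d1 d3); first by rewrite lt_min d10 divr_gt0.
move=> t /andP[t0]; rewrite lt_min ltr_pdivlMr// => /andP[td1 td2].
have u1 : nrm (exp_it h t - 1) < e / (4 * B) by apply: uP; rewrite t0.
have c1 : nrm (cis (q * t) - 1) < e / (4 * B).
  rewrite -cis0; apply: cP; rewrite subr0 normrM (ger0_norm t0).
  by apply: le_lt_trans td2; rewrite mulrC ler_wpM2l// lerDl.
rewrite /flow_defect -(nrm_exp_it_mulr hh t) mulrBl inner_flow_exp_it -scalerAl.
set u := exp_it h t in u1 *; set c := cis _ in c1 *.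
have -> : u * b - c *: (b * u) = (u - 1) * b - b * (u - 1) - (c - 1) *: (b * u).
  rewrite mulrBl mulrBr mul1r mulr1 scalerBl scale1r !opprB !addrA.
  by rewrite !subrK.
rewrite (le_lt_trans (nrmB _ _))// nrmZ nrm_exp_it_mulr//.
have bB : nrm b <= B by rewrite /B lerDl.
have h1 : nrm ((u - 1) * b - b * (u - 1)) <= 2 * (nrm (u - 1) * nrm b).
  rewrite (le_trans (nrmB _ _))//.
  by have := nrmM (u - 1) b; have := nrmM b (u - 1); rewrite [nrm b * _]mulrC; lra.
have h2 : nrm (u - 1) * nrm b <= e / (4 * B) * B.
  by rewrite ler_pM ?nrm_ge0 ?(ltW u1).
have h3 : nrm (c - 1) * nrm b <= e / (4 * B) * B.
  by rewrite ler_pM ?nrm_ge0 ?(ltW c1).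
have h4 : e / (4 * B) * B = e / 4 by field; rewrite gt_eqF.
rewrite h4 in h2 h3; lra.
Qed.

End InnerLimits.

(** * The left ideal annihilating a sequence of unit vectors *)

Section TopStateIdeal.
Context {R : realType} {A : cstarAlgType R}.
Variables (z : nat -> A).
Hypothesis nrm_z : forall n, nrm (z n) = 1.
Implicit Types a b x y : A.

Definition top_null a := forall e : R, 0 < e -> \forall n \near \oo, nrm (a * z n) < e.

Lemma top_null0 : top_null 0.
Proof. by move=> e e0; apply: nearW => n; rewrite mul0r nrm0. Qed.

Lemma top_nullD a b : top_null a -> top_null b -> top_null (a + b).
Proof.
move=> Na Nb e e0; have e20 : 0 < e / 2 by lra.
apply: filterS2 (Na _ e20) (Nb _ e20) => n an bn.
by rewrite mulrDl (le_lt_trans (nrmD _ _))//; lra.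
Qed.

Lemma top_nullMl a b : top_null b -> top_null (a * b).
Proof.
move=> Nb e e0; have a1 : 0 < nrm a + 1 by rewrite ltr_wpDl// nrm_ge0.
have := Nb (e / (nrm a + 1)); rewrite divr_gt0// => /(_ isT).
apply: filterS => n bn; rewrite -mulrA (le_lt_trans (nrmM _ _))//.
rewrite ltr_pdivlMr// mulrC mulrDl mul1r in bn.
by apply: le_lt_trans bn; rewrite lerDl nrm_ge0.
Qed.

Lemma top_null_closed a :
  (forall e : R, 0 < e -> exists2 b, top_null b & nrm (a - b) < e) -> top_null a.
Proof.
move=> aP e e0; have e20 : 0 < e / 2 by lra.
have [b Nb ab] := aP _ e20; apply: filterS (Nb _ e20) => n bn.
rewrite (le_lt_trans (nrm_le_dist (b * z n) _))// -mulrBl.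
by have := nrmM (a - b) (z n); rewrite nrm_z mulr1; lra.
Qed.

Lemma top_null1 : ~ top_null 1.
Proof.
move=> N1; have [n] := filter_ex (N1 1 ltr01).
by rewrite mul1r nrm_z ltxx.
Qed.

(** For [w = a z_n] the C*-identity gives [nrm (x w) ^+ 2 <= nrm w * nrm (star x * (x w))], and
    normality replaces the factor [star x] by [x]. *)
Lemma top_null_normal x a : star x * x = x * star x ->
  top_null (x * (x * a)) -> top_null (x * a).
Proof.
move=> xx Nxxa e e0; have a1 : 0 < nrm a + 1 by rewrite ltr_wpDl// nrm_ge0.
have := Nxxa (e ^+ 2 / (nrm a + 1)); rewrite divr_gt0 ?exprn_gt0// => /(_ isT).
apply: filterS => n; pose w := a * z n.
have -> : x * (x * a) * z n = x * (x * w) by rewrite /w !mulrA.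
rewrite -mulrA -/w => xxw.
have w_le : nrm w <= nrm a by rewrite (le_trans (nrmM _ _))// nrm_z mulr1.
rewrite -(@ltr_pXn2r _ 2)// ?nnegrE ?nrm_ge0 ?(ltW e0)//.
rewrite -nrm_star_mul starM -mulrA (le_lt_trans (nrmM _ _))// nrm_star.
rewrite -(nrm_normal_mul_mul _ xx); rewrite ltr_pdivlMr// mulrC in xxw.
apply: le_lt_trans xxw; rewrite ler_wpM2r ?nrm_ge0//; lra.
Qed.

Lemma top_null_normal_pow x a k : star x * x = x * star x ->
  top_null (x ^+ (2 ^ k) * a) -> top_null (x * a).
Proof.
move=> xx; elim: k => [|k IH]; first by rewrite expn0 expr1.
rewrite expnS mul2n -addnn exprD -mulrA => Nx; apply: IH.
apply: top_null_normal Nx; rewrite starX.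
by apply: commrX; apply: commr_sym; apply: commrX; apply: commr_sym.
Qed.

End TopStateIdeal.

(** The self-commutator [d] is self-adjoint and annihilated by [x] on both sides, hence by [star x]
    after taking adjoints. So [d * d = 0], and the C*-identity gives [d = 0]. *)
Lemma star_comm_normal (R : realType) (A : cstarAlgType R) (x : A) :
  x * (star x * x) = star x * x * x -> x * (x * star x) = x * star x * x ->
  star x * x = x * star x.
Proof.
move=> c1 c2; pose d := x * star x - star x * x.
have dd : star d = d by rewrite /d starB !starM starK.
have dx : d * x = 0 by rewrite /d mulrBl -c1 mulrA subrr.
have xd : x * d = 0 by rewrite /d mulrBr c2 mulrA subrr.
have dxs : d * star x = 0 by rewrite -dd -starM xd star0.
have : nrm d ^+ 2 = 0.
  rewrite -nrm_star_mul dd {2}/d mulrBr !mulrA dx dxs !mul0r subrr.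
  by rewrite nrm0.
move=> /eqP; rewrite expf_eq0 /= => /eqP/nrm_eq0/eqP.
by rewrite subr_eq0 eq_sym => /eqP.
Qed.

(** * Eigenvectors of the flow and the commutant of its fixed points *)

Section ApproximatelyInnerCompactFlows.
Context {R : realType} {A : cstarAlgType R}.
Variable alpha : R -> Aut A.
Hypothesis alpha_flow : is_flow alpha.
Hypothesis alpha_inner : approximately_inner alpha.
Hypothesis alpha_compact : compact_flow alpha.
Hypothesis A_simple : simple_cstar A.
Implicit Types (a b x y : A) (s t p q : R).

Let al t x : A := aut_fun (alpha t) x.

Let al_auto t : star_automorphism (aut_fun (alpha t)).
Proof. exact: (set_valP (alpha t)). Qed.

Let al_linear t (c : R[i]) x y : al t (c *: x + y) = c *: al t x + al t y.
Proof. exact: (star_automorphism_linear (al_auto t)). Qed.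

Let al_sub t x y : al t (x - y) = al t x - al t y.
Proof. by rewrite -scaleN1r addrC al_linear scaleN1r addrC. Qed.

Let alM t x y : al t (x * y) = al t x * al t y.
Proof. exact: (star_automorphism_mul (al_auto t)).2. Qed.

Let al_star t x : al t (star x) = star (al t x).
Proof. exact: (star_automorphism_star (al_auto t)). Qed.

Let al0 x : al 0 x = x.
Proof. exact: flow0. Qed.

Let alD s t x : al (s + t) x = al s (al t x).
Proof. exact: flowD. Qed.

Let inner_cvg : exists h : nat -> A, (forall n, star (h n) = h n) /\
  forall t x (e : R), 0 < e ->
    \forall n \near \oo, nrm (al t x - inner_flow (h n) t x) < e.
Proof.
have [h [hh hP]] := alpha_inner; exists h; split => // t x e e0.
have /cvg_nrmP/(_ _ e0) := hP t x; apply: filterS => n.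
by rewrite exp_itN.
Qed.

Lemma nrm_flow t x : nrm (al t x) = nrm x.
Proof.
have [h [hh hP]] := inner_cvg; apply/eqP; rewrite eq_le.
apply/andP; split; apply/ler_addgt0Pr => e e0; have [n] := filter_ex (hP t x _ e0).
  by have := nrm_le_dist (inner_flow (h n) t x) (al t x); rewrite nrm_inner_flow//; lra.
have := nrm_le_dist (al t x) (inner_flow (h n) t x).
by rewrite nrm_inner_flow// nrm_distC; lra.
Qed.

Lemma flow_eps_continuous x t (e : R) : 0 < e ->
  exists2 d, 0 < d & forall s, `|s - t| < d -> nrm (al s x - al t x) < e.
Proof.
move=> e0; have /cvg_nrmP/(_ _ e0) := @flow_continuous _ _ _ alpha_flow x t.
move=> /nbhs_ballP[d /= d0 dP]; exists d => // s st.
by rewrite nrm_distC; apply: dP; rewrite -ball_normE /= distrC.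
Qed.

(** Evaluation at [x] is continuous for pointwise convergence, so it maps the compact closure of the
    flow onto a compact set containing the orbit of [x]. *)
Lemma flow_totally_bounded x (e : R) : 0 < e ->
  exists J (c : 'I_J -> A), forall t, exists j, nrm (al t x - c j) < e.
Proof.
move=> e0; pose ev (f : Aut A) : A := aut_fun f x.
have ev_cont : continuous ev.
  move=> f; apply: (@continuous_comp _ _ _ (set_val : Aut A -> {ptws A -> A})
    (fun g : {ptws A -> A} => g x)).
    exact: initial_continuous.
  exact: proj_continuous.
have : compact [set ev f | f in closure (range alpha)].
  apply: continuous_compact alpha_compact.
  by apply: continuous_subspaceT => f; exact: ev_cont.
rewrite compact_cover => /(_ A setT (fun c => ball c e%:C)).
case.
- by move=> c _; apply: ball_open; rewrite ltcR.
- by move=> y _; exists y => //; apply: ballxx; rewrite ltcR.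
move=> D _ cov; exists (size (finmap.enum_fset D)), (fun j => nth 0 (finmap.enum_fset D) j) => t.
have [|c /= cD] := cov (al t x).
  by exists (alpha t) => //; apply: subset_closure; exists t.
rewrite -ball_normE /= nrmE ltcR nrm_distC => xc.
have cs : (index c (finmap.enum_fset D) < size (finmap.enum_fset D))%N by rewrite index_mem.
by exists (Ordinal cs); rewrite /= nth_index.
Qed.

Definition flow_eigenvector p x := forall t, al t x = cis (p * t) *: x.

Lemma flow_eigenvectorM p q x y : flow_eigenvector p x -> flow_eigenvector q y ->
  flow_eigenvector (p + q) (x * y).
Proof.
by move=> xp yq t; rewrite alM xp yq -scalerAl -scalerAr scalerA -cisD mulrDl.
Qed.

Lemma flow_eigenvectorX p x n : flow_eigenvector p x ->
  flow_eigenvector (p *+ n.+1) (x ^+ n.+1).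
Proof.
move=> xp; elim: n => [|n IH]; first by rewrite expr1.
by rewrite mulrS exprS; exact: flow_eigenvectorM.
Qed.

Lemma flow_eigenvector_star p x : flow_eigenvector p x ->
  flow_eigenvector (- p) (star x).
Proof. by move=> xp t; rewrite al_star xp starZ conj_cis mulNr. Qed.

Lemma flow_eigenvectors_dense (W : set A) : closed W -> W 0 ->
  (forall x y, W x -> W y -> W (x + y)) ->
  (forall (a : R[i]) x, W x -> W (a *: x)) ->
  (forall t x, W x -> W (al t x)) ->
  forall x (e : R), W x -> 0 < e -> exists P (y : nat -> A) (p : nat -> R),
    (forall j, W (y j) /\ flow_eigenvector (p j) (y j)) /\
    nrm (x - \sum_(j < P) y j) < e.
Proof.
exact: (eigenvectors_dense al_linear nrm_flow al0 alD flow_eps_continuous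
  flow_totally_bounded).
Qed.

Lemma top_vectors : exists z : nat -> A, (forall n, nrm (z n) = 1) /\
  forall q b, 0 < q -> flow_eigenvector q b -> top_null z b.
Proof.
have [h [hh hP]] := inner_cvg.
have Sn0 n : 0 < n.+1%:R^-1 :> R by rewrite invr_gt0.
have /choice[M MP] n := top_approximate_eigenvector (hh n) (Sn0 n).
have /choice[z zP] := MP; exists z; split => [n|q b q0 bq e e0].
  by have [] := zP n.
pose B := nrm b; have B0 : 0 <= B := nrm_ge0 b.
have e8 : 0 < e / 8 by lra.
(* [T], [d] and the threshold on [1 / (n + 1)] bound each of the three terms of [nrm_mul_top]
   divided by [q] by [e / 8]. With the defect [e / 8] the total is at most [e / 2]. *)
pose T := 16 * (B + 1) / (q * e).
have T0 : 0 < T by rewrite divr_gt0 ?mulr_gt0// ltr_wpDl.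
pose d := q * e / 8; have d0 : 0 < d by rewrite divr_gt0 ?mulr_gt0.
have unif := subadditive_cvg0_uniform
  (fun n t => nrm_ge0 (inner_flow (h n) t b - cis (q * t) *: b))
  (fun n => @flow_defect_continuous R A (h n) q b (hh n))
  (fun n t => @flow_defectN R A (h n) q b t (hh n))
  (fun n s t => @flow_defectD R A (h n) q b s t (hh n)).
have {}unif := unif _ T (e / 8) e8.
have g0 : 0 < d / (B + e) by rewrite divr_gt0// ltr_wpDl.
have {unif} : \forall n \near \oo, forall t, 0 <= t <= T ->
    flow_defect (h n) q b t <= e / 8.
  apply: unif => t; apply/cvgrPdist_lt => r r0.
  apply: filterS (hP t b _ r0) => n.
  by rewrite sub0r normrN ger0_norm ?nrm_ge0// /flow_defect bq nrm_distC.
apply: filterS2 (natSinv_lt g0) => n gn defect.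
have [z1 hz hM] := zP n.
have := nrm_mul_top (hh n) q0 T0 d0 defect z1 hz hM.
move=> /le_lt_trans; apply.
have h1 : q^-1 * (2 * B / T) <= e / 8.
  have -> : q^-1 * (2 * B / T) = e / 8 * (B / (B + 1)).
    by rewrite /T; field; rewrite !gt_eqF// ltr_wpDl.
  have : B / (B + 1) <= 1 by rewrite ler_pdivrMr ?ltr_wpDl// mul1r lerDl.
  nra.
have h2 : q^-1 * d = e / 8 by rewrite /d; field; rewrite gt_eqF.
have h3 : q^-1 * ((B + e / 8) * n.+1%:R^-1) <= e / 8.
  rewrite -h2 ler_pM2l ?invr_gt0//.
  move: gn; rewrite ltr_pdivlMr ?ltr_wpDl// => /ltW; apply: le_trans.
  by rewrite mulrC ler_pM2l ?invr_gt0//; lra.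
rewrite -/B [q^-1 * (_ + _)]mulrDr [q^-1 * (_ + _)]mulrDr.
move: h1 h2 h3; move: (q^-1 * (2 * B / T)) (q^-1 * d).
move: (q^-1 * ((B + e / 8) / n.+1%:R)) => r1 r2 r3; lra.
Qed.

Lemma normal_eigenvector_eq0_gt0 p x : 0 < p -> flow_eigenvector p x ->
  star x * x = x * star x -> x = 0.
Proof.
move=> p0 xp xx; have [z [z1 zN]] := top_vectors.
(* Quantifying over the right factor [a] turns the left ideal into a two-sided one. *)
pose I := [set y | forall a, top_null z (y * a)].
have I_ideal : closed_ideal I.
  split.
  - by move=> a; rewrite mul0r; exact: top_null0.
  - by move=> y y' Iy Iy' a; rewrite mulrDl; exact: top_nullD.
  - move=> c y Iy a; rewrite -scalerAl -[y * a]mul1r scalerAl.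
    exact: top_nullMl.
  - by move=> y y' Iy' a; rewrite -mulrA; exact: top_nullMl.
  - by move=> y y' Iy a; rewrite -mulrA.
  - apply: closed_nrm => y yP a; apply: top_null_closed => // e e0.
    have a1 : 0 < nrm a + 1 by rewrite ltr_wpDl// nrm_ge0.
    have [|y' Iy' yy'] := yP (e / (nrm a + 1)); first by rewrite divr_gt0.
    exists (y' * a) => //; rewrite -mulrBl (le_lt_trans (nrmM _ _))//.
    rewrite ltr_pdivlMr// mulrDr mulr1 in yy'; apply: le_lt_trans yy'.
    by rewrite lerDl nrm_ge0.
have Ix : I x.
  move=> a; apply: top_null_closed => // e e0.
  have x1 : 0 < nrm x + 1 by rewrite ltr_wpDl// nrm_ge0.
  have ex0 : 0 < e / (nrm x + 1) by rewrite divr_gt0.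
  have [||||||P [y [r [yr ay]]]] := @flow_eigenvectors_dense setT _ _ _ _ _ a _ _ ex0 => //.
  exists (x * \sum_(j < P) y j).
    rewrite mulr_sumr; apply: (big_ind (top_null z)).
    - exact: top_null0.
    - by move=> ? ?; exact: top_nullD.
    move=> j _; have [_ yj] := yr j.
    pose k := Num.bound (`|r j| / p).
    apply: (@top_null_normal_pow _ _ z z1 x (y j) k) => //.
    have := flow_eigenvectorX (2 ^ k).-1 xp; rewrite prednK ?expn_gt0// => xk.
    apply: (zN (p *+ 2 ^ k + r j)); last exact: flow_eigenvectorM.
    have : `|r j| < p * (2 ^ k)%:R.
      rewrite mulrC -ltr_pdivrMr//; apply: (@lt_trans _ _ k%:R).
        by rewrite archi_boundP// divr_ge0// ltW.
      by rewrite ltr_nat ltn_expl.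
    by rewrite mulr_natr ltr_norml; lra.
  rewrite -mulrBr (le_lt_trans (nrmM _ _))// mulrC.
  rewrite ltr_pdivlMr// mulrDr mulr1 in ay; apply: le_lt_trans ay.
  by rewrite lerDl nrm_ge0.
have [I0|IT] := A_simple I_ideal; first by move: Ix; rewrite I0.
have /(_ 1) : I 1 by rewrite IT.
by rewrite mulr1 => /(top_null1 z1).
Qed.

Lemma normal_eigenvector_fixed p x : flow_eigenvector p x ->
  star x * x = x * star x -> forall t, al t x = x.
Proof.
have al_zero t : al t 0 = 0 by apply: nrm_eq0; rewrite nrm_flow nrm0.
move=> xp xx t; have [p0|p0|p0] := ltgtP 0 p.
- by rewrite (normal_eigenvector_eq0_gt0 p0 xp xx) al_zero.
(* A negative frequency becomes positive for the adjoint, which is again normal. *)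
- have /(congr1 (@star R A)) : star x = 0.
    apply: (normal_eigenvector_eq0_gt0 _ (flow_eigenvector_star xp)); last by rewrite starK.
    by rewrite oppr_gt0.
  by rewrite starK star0 => ->; rewrite al_zero.
by rewrite xp -p0 mul0r cis0 scale1r.
Qed.

Lemma commutant_maximal_abelian : exists B : set A,
  maximal_abelian_cstar_subalgebra B /\ forall x, B x -> forall t, al t x = x.
Proof.
(* Self-adjointness makes the commutant of [S] closed under [star], and fixedness makes it invariant
   under the flow. *)
pose good (S : set A) := (forall x, S x -> star x = x /\ forall t, al t x = x) /\
  (forall x y, S x -> S y -> x * y = y * x).
have [F Fgood Ftot|S [[Sfix Scomm] Smax]] := @Zorn_bigcup A good.
  split=> [x [X FX Xx]|x y [X FX Xx] [Y FY Yy]].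
    by have [+ _] := Fgood _ FX; exact.
  have [XY|YX] := Ftot _ _ FX FY.
    by have [_] := Fgood _ FY; apply => //; exact: XY.
  by have [_] := Fgood _ FX; apply => //; exact: YX.
pose C : set A := [set x | forall s : A, S s -> x * s = s * x].
have C0 : C 0 by move=> s _; rewrite mul0r mulr0.
have CD x y : C x -> C y -> C (x + y).
  by move=> Cx Cy s Ss; rewrite mulrDl mulrDr Cx// Cy.
have CZ (c : R[i]) x : C x -> C (c *: x).
  by move=> Cx s Ss; rewrite -scalerAl -scalerAr Cx.
have CM x y : C x -> C y -> C (x * y).
  by move=> Cx Cy s Ss; rewrite -mulrA Cy// mulrA Cx// mulrA.
have Cstar x : C x -> C (star x).
  move=> Cx s Ss; have [ss _] := Sfix _ Ss.
  by rewrite -[s in LHS]ss -starM -Cx// starM ss.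
have Cal t x : C x -> C (al t x).
  by move=> Cx s Ss; have [_ sfix] := Sfix _ Ss; rewrite -(sfix t) -!alM Cx.
have Cclosed : closed C.
  apply: closed_nrm => x xC s Ss; apply: nrm_dist_le0 => e e0.
  have s0 : 0 < 2 * (nrm s + 1) by rewrite mulr_gt0// ltr_wpDl// nrm_ge0.
  have [|y Cy xy] := xC (e / (2 * (nrm s + 1))); first by rewrite divr_gt0.
  have -> : x * s - s * x = (x - y) * s - s * (x - y).
    by rewrite mulrBl mulrBr Cy// opprB addrA subrK.
  have := nrmM (x - y) s; have := nrmM s (x - y).
  move: xy; rewrite ltr_pdivlMr// => xy h1 h2.
  rewrite (le_trans (nrmB _ _))//; have := nrm_ge0 (x - y); nra.
have S_selfadj x : C x -> star x = x -> (forall t, al t x = x) -> S x.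
  move=> Cx xx xfix; apply: contrapT => nSx.
  apply: (Smax (S `|` [set x])).
    split=> [|sub]; first by move=> y Sy; left.
    by apply: nSx; apply: sub; right.
  split=> [y [/Sfix//|->//]|y y' [Sy|->] [Sy'|->]//]; first exact: Scomm.
    exact/esym/Cx.
  exact: Cx.
have fixZ (c : R[i]) x y : (forall t, al t x = x) -> (forall t, al t y = y) ->
    forall t, al t (c *: x + y) = c *: x + y.
  by move=> xf yf t; rewrite al_linear xf yf.
(* The self-adjoint and skew parts of [x] yield self-adjoint fixed elements [u] and [v] of [C]. They
   belong to [S] by maximality, so all of [C] commutes with them. *)
have Ccomm x c : C x -> (forall t, al t x = x) -> C c -> c * x = x * c.
  move=> Cx xfix Cc.
  have sfix t : al t (star x) = star x by rewrite al_star xfix.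
  pose u := x + star x; pose v := 'i *: (x - star x).
  have Su : S u.
    apply: S_selfadj; first exact/CD/Cstar.
      by rewrite /u starD starK addrC.
    by move=> t; have := fixZ 1 x (star x) xfix sfix t; rewrite scale1r.
  have Sv : S v.
    apply: S_selfadj.
    - by apply: (CZ); apply: CD => //; rewrite -scaleN1r; apply: (CZ); exact: Cstar.
    - rewrite /v starZ starB starK -[in RHS]opprB scalerN -scaleNr.
      congr (_ *: _).
      by apply/eqP; rewrite eq_complex /= oppr0 !eqxx.
    move=> t; rewrite /v -scaleN1r addrC -[_ *: _]addr0.
    apply: (fixZ 'i) => [|s]; first exact: (fixZ (-1)).
    by apply: nrm_eq0; rewrite nrm_flow nrm0.
  have xE : 2%:R *: x = u - 'i *: v.
    rewrite /u /v scalerA -expr2 sqr_i scaleN1r opprK scaler_nat mulr2n.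
    by rewrite addrACA addrN addr0.
  have : 2%:R *: (c * x) = 2%:R *: (x * c).
    by rewrite scalerAr scalerAl xE mulrBr mulrBl -scalerAr -scalerAl !Cc.
  by apply: scalerI; rewrite pnatr_eq0.
have Cfix x : C x -> forall t, al t x = x.
  move=> Cx t; apply: nrm_dist_le0 => e e0; have e20 : 0 < e / 2 by lra.
  have [P [y [p [yP xy]]]] := flow_eigenvectors_dense Cclosed C0 CD CZ Cal Cx e20.
  have yfix j s : al s (y j) = y j.
    have [Cy yp] := yP j; apply: (normal_eigenvector_fixed yp).
    have star_fix : forall r, al r (star (y j) * y j) = star (y j) * y j.
      move=> r; rewrite alM al_star yp starZ -scalerAl -scalerAr scalerA conj_cis.
      by rewrite -cisD addNr cis0 scale1r.
    have fix_star : forall r, al r (y j * star (y j)) = y j * star (y j).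
      move=> r; rewrite alM al_star yp starZ -scalerAl -scalerAr scalerA conj_cis.
      by rewrite -cisD subrr cis0 scale1r.
    have k1 := Ccomm _ _ (CM _ _ (Cstar _ Cy) Cy) star_fix Cy.
    have k2 := Ccomm _ _ (CM _ _ Cy (Cstar _ Cy)) fix_star Cy.
    exact: star_comm_normal.
  pose w := \sum_(j < P) y j.
  have wfix : al t w = w.
    apply: (big_ind (fun v => al t v = v)) => [|a b af bf|j _]; last exact: yfix.
      by apply: nrm_eq0; rewrite nrm_flow nrm0.
    by rewrite -[a]scale1r al_linear af bf.
  rewrite (le_trans (nrm_dist_triangle w _ _))// -[in X in X + _]wfix.
  by rewrite -al_sub nrm_flow [X in _ + X]nrm_distC; rewrite -/w in xy; lra.
exists C; split; last exact: Cfix.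
have SC : S `<=` C by move=> x Sx s Ss; exact: Scomm.
split.
  split; last by move=> x y Cx Cy; apply/esym/Ccomm => //; exact: Cfix.
  by split.
(* An abelian [B'] containing [C] contains [S], so it commutes with [S] and lies in the commutant
   [C]. *)
move=> B' [_ B'comm] [CB' B'C]; apply: B'C => x Bx s Ss.
by apply: B'comm => //; apply: CB'; exact: SC.
Qed.

Lemma fixed_generator_domain x : (forall t, al t x = x) -> generator_domain alpha x.
Proof.
move=> xfix; rewrite /generator_domain /=.
rewrite (_ : flow_quotient alpha x = fun=> 0); first exact: is_cvg_cst.
by apply/funext => t; rewrite /flow_quotient -/(al t x) xfix subrr scaler0.
Qed.

End ApproximatelyInnerCompactFlows.

Theorem proposition2p2 (R : realType) (A : cstarAlgType R) (alpha : R -> Aut A)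
    (A_separable : separable A) (A_simple : simple_cstar A)
    (alpha_flow : is_flow alpha)
    (alpha_inner : approximately_inner alpha)
    (alpha_compact : compact_flow alpha) :
  exists B : set A,
    maximal_abelian_cstar_subalgebra B /\ B `<=` generator_domain alpha.
Proof.
have [B [Bmasa Bfix]] :=
  commutant_maximal_abelian alpha_flow alpha_inner alpha_compact A_simple.
by exists B; split => // x /Bfix; exact: fixed_generator_domain.
Qed.
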